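(* Let $\alpha\in(1,2]$, $\beta>0$ with $\beta\neq d$, $C_\beta>0$, let $G$ be a probability measure on $\mathbb{R}$ in the normal domain of attraction of an $\alpha$-stable law (in the sense given in the context), and for $\mu\in\mathcal{M}_{\alpha,\beta}$ let $$ J(\mu)=\int_{\mathbb{R}^d\times\mathbb{R}^+\times\mathbb{R}}m\,\mu(B(x,r))\,\widetilde N_\beta(dx,dr,dm), $$ where $\widetilde N_\beta$ is the compensated Poisson random measure with intensity $C_\beta r^{-\beta-1}\,dx\,dr\,G(dm)$. Then the field $J$ is stationary and isotropic on $\mathcal{M}_{\alpha,\beta}$, i.e. for every $s\in\mathbb{R}^d$ and every $\Theta\in\mathcal{O}(\mathbb{R}^d)$ the fields $(J(\tau_s\mu))_{\mu\in\mathcal{M}_{\alpha,\beta}}$, $(J(\Theta\mu))_{\mu\in\mathcal{M}_{\alpha,\beta}}$ and $(J(\mu))_{\mu\in\mathcal{M}_{\alpha,\beta}}$ have the same finite-dimensional distributions. Moreover, $J$ is aggregate similar: for every integer $m\ge1$, the fields $$ (J(\mu_{a_m}))_{\mu\in\mathcal{M}_{\alpha,\beta}}\quad\text{and}\quad\Big(\sum_{i=1}^m J^i(\mu)\Big)_{\mu\in\mathcal{M}_{\alpha,\beta}} $$ have the same finite-dimensional distributions, where $J^i$, $1\le i\le m$, are independent copies of $J$ and $a_m=m^{1/(d-\beta)}$.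
   Context: $d\ge1$ is an integer, $B(x,r)=\{y\in\mathbb{R}^d:\|y-x\|<r\}$ with $\|\cdot\|$ Euclidean, $\mathbb{R}^+=(0,\infty)$, $\mathcal{O}(\mathbb{R}^d)$ is the orthogonal group. $\varepsilon(a)=1,-1,0$ according to $a>0$, $a<0$, $a=0$. $\mathcal{M}$ is the space of signed measures on $\mathbb{R}^d$ with finite total variation; $\mathcal{M}_{\alpha,\beta}$ is the set of $\mu\in\mathcal{M}$ for which there exist a finite constant $C$ and $0<p<\beta<q$ with $\int_{\mathbb{R}^d}|\mu(B(x,r))|^\alpha dx\le C\min(r^p,r^q)$ for all $r>0$. For Borel $A$: $\tau_s\mu(A)=\mu(A-s)$, $\Theta\mu(A)=\mu(\Theta^{-1}A)$, $\mu_a(A)=\mu(a^{-1}A)$ for $a>0$; these operations map $\mathcal{M}_{\alpha,\beta}$ into itself. Assumption on $G$: for some $\sigma>0$, $b\in[-1,1]$, $\tau\in\mathbb{R}$, as $\theta\to0$, $\varphi_G(\theta)=1+i\theta\tau-\sigma^\alpha|\theta|^\alpha(1-ib\,\varepsilon(\theta)\tan(\pi\alpha/2))+o(|\theta|^\alpha)$, where $\varphi_G$ is the characteristic function of $G$. With respect to a compensated Poisson random measure of intensity $n$, $\int h\,d\widetilde N$ is well defined when $\int(|h|\wedge h^2)\,dn<\infty$, is linear in $h$, and has characteristic function $\theta\mapsto\exp\big(\int(e^{i\theta h}-1-i\theta h)\,dn\big)$. $J(\mu)$ is well defined in this sense for $\mu\in\mathcal{M}_{\alpha,\beta}$. *)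

(* Defs.v *)
From HB Require Import structures.
From mathcomp Require Import all_boot all_order all_algebra.
From mathcomp Require Import complex.
From mathcomp Require Import all_classical all_reals all_analysis.
From mathcomp Require Import interval_inference measurable_realfun.

Set Implicit Arguments.
Unset Strict Implicit.
Unset Printing Implicit Defensive.

Import Order.TTheory GRing.Theory Num.Theory.
Import numFieldNormedType.Exports.

Local Open Scope classical_set_scope.
Local Open Scope ring_scope.

Section euclidean_space.
Context {R : realType} {d : nat}.
Implicit Types (x y s : d.-tuple R).

(* R^d is the type [d.-tuple R], with the library's product sigma-algebra. *)
Definition eucl_dist x y : R :=
  Num.sqrt (\sum_(i < d) (tnth y i - tnth x i) ^+ 2).

Definition eucl_ball x (r : R) : set (d.-tuple R) :=
  [set y | eucl_dist x y < r].

Definition vshift s x : d.-tuple R := [tuple tnth x i + tnth s i | i < d].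

Definition vscale (a : R) x : d.-tuple R := [tuple a * tnth x i | i < d].

Definition vlin (Theta : 'M[R]_d) x : d.-tuple R :=
  [tuple \sum_(j < d) Theta i j * tnth x j | i < d].

Definition orthogonal_mx (Theta : 'M[R]_d) : Prop := Theta^T *m Theta = 1%:M.

Lemma measurable_vshift s : measurable_fun setT (vshift s).
Proof.
apply/measurable_fun_tnthP => i.
rewrite (_ : _ \o _ = (fun x => tnth x i + tnth s i)); last first.
  by apply/funext => x /=; rewrite tnth_mktuple.
apply: measurable_funD => //; exact: measurable_tnth.
Qed.

Lemma measurable_vscale a : measurable_fun setT (vscale a).
Proof.
apply/measurable_fun_tnthP => i.
rewrite (_ : _ \o _ = (fun x => a * tnth x i)); last first.
  by apply/funext => x /=; rewrite tnth_mktuple.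
apply: measurable_funM => //; exact: measurable_tnth.
Qed.

Lemma measurable_vlin Theta : measurable_fun setT (vlin Theta).
Proof.
apply/measurable_fun_tnthP => i.
rewrite (_ : _ \o _ = (fun x => \sum_(j < d) Theta i j * tnth x j)); last first.
  by apply/funext => x /=; rewrite tnth_mktuple.
apply: measurable_sum => j; apply: measurable_funM => //; exact: measurable_tnth.
Qed.

End euclidean_space.

Lemma sigma_finite_product d1 d2 (T1 : measurableType d1)
    (T2 : measurableType d2) (R : realType)
    (m1 : {sigma_finite_measure set T1 -> \bar R})
    (m2 : {sigma_finite_measure set T2 -> \bar R}) :
  sigma_finite setT (m1 \x m2)%E.
Proof.
have /sigma_finiteP[F [TF ndF Foo]] := sigma_finiteT m1.
have /sigma_finiteP[G [TG ndG Goo]] := sigma_finiteT m2.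
exists (fun n => F n `*` G n).
  rewrite -setXTT TF TG predeqE => -[x y]; split.
    move=> [/= [n _ Fnx] [k _ Gky]]; exists (maxn n k) => //; split.
    - by move: x Fnx; exact/subsetPset/ndF/leq_maxl.
    - by move: y Gky; exact/subsetPset/ndG/leq_maxr.
  by move=> [n _ []/= ? ?]; split; exists n.
move=> k; have [? ?] := Foo k; have [? ?] := Goo k.
split; first exact: measurableX.
by rewrite product_measure1E// lte_mul_pinfty// ge0_fin_numE.
Qed.

Section lebesgue_tuple.
Context {R : realType}.

Section step.
Variables (n : nat) (m : {sigma_finite_measure set (n.-tuple R) -> \bar R}).

Let consf (p : R * n.-tuple R) : n.+1.-tuple R := [tuple of p.1 :: p.2].

Let measurable_consf : measurable_fun setT consf.
Proof. exact: measurable_cons. Qed.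

Definition lebesgue_cons : set (n.+1.-tuple R) -> \bar R :=
  pushforward (@lebesgue_measure R \x m)%E consf.

Let lebesgue_cons0 : lebesgue_cons set0 = 0%E.
Proof. by rewrite /lebesgue_cons /pushforward preimage_set0 measure0. Qed.

Let lebesgue_cons_ge0 A : (0 <= lebesgue_cons A)%E.
Proof. exact: measure_ge0. Qed.

Let lebesgue_cons_sigma_additive : semi_sigma_additive lebesgue_cons.
Proof.
have h := measure_semi_sigma_additive
  (s := measure_function_pushforward__canonical__measure_function_Measure
     (lebesgue_measure \x m)%E measurable_consf).
exact: h.
Qed.

HB.instance Definition _ := isMeasure.Build _ _ _ lebesgue_cons
  lebesgue_cons0 lebesgue_cons_ge0 lebesgue_cons_sigma_additive.

Let lebesgue_cons_sigma_finite : sigma_finite setT lebesgue_cons.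
Proof.
have [F FT mF] := sigma_finite_product (@lebesgue_measure R) m.
have mu : measurable_fun [set: n.+1.-tuple R]
    (fun t => (thead t, [tuple of behead t])).
  apply: measurable_fun_pair; first exact: measurable_tnth.
  exact: measurable_behead.
exists (fun k => (fun t => (thead t, [tuple of behead t])) @^-1` F k).
  apply/esym; rewrite -preimage_bigcup -FT; exact: preimage_setT.
move=> k; have [mFk Fkoo] := mF k; split.
  by rewrite -[X in measurable X]setTI; exact: mu.
rewrite /lebesgue_cons /pushforward.
rewrite (_ : _ @^-1` _ = F k)//; apply/seteqP.
suff E p : (thead (consf p), [tuple of behead (consf p)]) = p.
  by split => p /=; rewrite E.
by case: p => x t; congr pair; apply/val_inj.
Qed.

HB.instance Definition _ := Measure_isSigmaFinite.Build _ _ _ lebesgue_cons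
  lebesgue_cons_sigma_finite.

End step.

Fixpoint lebesgue_tuple (n : nat) :
    {sigma_finite_measure set (n.-tuple R) -> \bar R} :=
  match n with
  | 0 => dirac ([tuple] : 0.-tuple R)
  | n'.+1 => lebesgue_cons (lebesgue_tuple n')
  end.

Lemma lebesgue_tuple_box (n : nat) (A : 'I_n -> set R) :
  (forall i, measurable (A i)) ->
  lebesgue_tuple n [set x | forall i, A i (tnth x i)] =
  (\prod_(i < n) lebesgue_measure (A i))%E.
Proof.
elim: n A => [|n IH] A mA /=.
  rewrite big_ord0 diracE mem_set//=; by case.
rewrite big_ord_recl -IH//.
rewrite /lebesgue_cons /pushforward.
rewrite (_ : _ @^-1` _ =
  A ord0 `*` [set x : n.-tuple R | forall i, A (lift ord0 i) (tnth x i)]).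
  rewrite product_measure1E//; first exact: mA.
  rewrite (_ : [set x | _] = \big[setI/setT]_(i < n)
      (fun x : n.-tuple R => tnth x i) @^-1` A (lift ord0 i)).
    apply: bigsetI_measurable => i _.
    rewrite -[X in measurable X]setTI; exact: measurable_tnth.
  apply/seteqP; split => x /=.
    move=> h; elim/big_ind: _ => // i _; exact: h.
  move=> + i; rewrite (bigD1 i)//= => -[] //.
apply/seteqP; split => -[x t] /= h.
  split; first by have := h ord0.
  by move=> i; have := h (lift ord0 i); rewrite tnthS.
move=> i; case: (unliftP ord0 i) => [j ->|->]; last exact: h.1.
rewrite tnthS; exact: h.2.
Qed.

End lebesgue_tuple.

Definition signed_measure (R : realType) (d : nat) : Type :=
  {charge set (d.-tuple R) -> \bar R}.

(* The image of a charge by a measurable map, [A |-> nu (f @^-1` A)]. *)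
Definition cpushforward d1 d2 (T1 : measurableType d1) (T2 : measurableType d2)
    (R : realType) (f : T1 -> T2) (mf : measurable_fun setT f)
    (nu : {charge set T1 -> \bar R}) : {charge set T2 -> \bar R} :=
  measure_function_pushforward__canonical__charge_Charge nu mf.

Section signed_measures.
Context {R : realType} {d : nat}.
Implicit Types (mu : signed_measure R d).

Definition mtranslate (s : d.-tuple R) mu : signed_measure R d :=
  cpushforward (measurable_vshift s) mu.

Definition mrotate (Theta : 'M[R]_d) mu : signed_measure R d :=
  cpushforward (measurable_vlin Theta) mu.

Definition mdilate (a : R) mu : signed_measure R d :=
  cpushforward (measurable_vscale a) mu.

(* Charges are finite valued, so that [fine] only casts from \bar R to R;
   a charge on a sigma-algebra has finite total variation. *)
Definition Mspace (alpha beta : R) : set (signed_measure R d) :=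
  [set mu | exists C p q : R, [/\ 0 < p < beta, beta < q &
    forall r : R, 0 < r ->
      (\int[lebesgue_tuple d]_x (`|fine (mu (eucl_ball x r))| `^ alpha)%:E
        <= (C * Num.min (r `^ p) (r `^ q))%:E)%E]].

End signed_measures.

Section characteristic_function.
Context {R : realType}.
Local Open Scope complex_scope.

Definition char_fun (G : probability R R) (theta : R) : R[i] :=
  (\int[G]_x cos (theta * x))%R +i* (\int[G]_x sin (theta * x))%R.

Definition normal_attraction (alpha : R) (G : probability R R) : Prop :=
  exists sigma b tau : R, [/\ 0 < sigma, -1 <= b <= 1 &
    Normc.normc (char_fun G theta -
        (1 + 'i * theta%:C * tau%:C
         - (sigma `^ alpha)%:C * (`|theta| `^ alpha)%:C
           * (1 - 'i * b%:C * (Num.sg theta)%:C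
                  * (tan (pi * alpha / 2))%:C)))
      / `|theta| `^ alpha @[theta --> 0^'] --> (0 : R)].

End characteristic_function.

(* Triples ((x, r), m); [lebesgue_measure] lives on [measurableTypeR R]. *)
Notation ball_space R d := (d.-tuple R * measurableTypeR R * R)%type.

Section intensity.
Context {R : realType} (d : nat) (beta : R) (Cb : {posnum R}).
Variable G : probability R R.

Definition reference_measure : {measure set (ball_space R d) -> \bar R} :=
  ((lebesgue_tuple d \x @lebesgue_measure R) \x G)%E.

Definition radial_density (r : R) : R :=
  if 0 < r then Cb%:num * r `^ (- beta - 1) else 0.

(* The radius ranges over all of R, but no mass is put on r <= 0. *)
Definition intensity : set (ball_space R d) -> \bar R := fun A =>
  (\int[reference_measure]_(z in A)
     (radial_density z.1.2)%:E)%E.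

Let density_ge0 (z : ball_space R d) : (0 <= (radial_density z.1.2)%:E)%E.
Proof.
rewrite lee_fin /radial_density.
by case: ifP => // _; rewrite mulr_ge0 ?powR_ge0.
Qed.

Let measurable_density :
  measurable_fun setT (fun z : ball_space R d => (radial_density z.1.2)%:E).
Proof.
apply/measurable_EFinP; apply: (@measurableT_comp _ _ _ _ _ _ radial_density).
  apply: measurable_fun_ifT => //.
    exact: measurable_fun_ltr.
  by apply: measurable_funM => //; exact: measurable_powR.
exact: measurableT_comp.
Qed.

Let intensity0 : intensity set0 = 0%E.
Proof. exact: integral_set0. Qed.

Let intensity_ge0 A : (0 <= intensity A)%E.
Proof. by apply: integral_ge0 => z _; exact: density_ge0. Qed.

Let intensity_sigma_additive : semi_sigma_additive intensity.
Proof.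
exact: (@semi_sigma_additive_nng_induced _ _ _
  reference_measure _ measurable_density).
Qed.

HB.instance Definition _ := isMeasure.Build _ _ _ intensity
  intensity0 intensity_ge0 intensity_sigma_additive.

End intensity.

Arguments intensity {R} d beta Cb G _.

Section independence.
Context {R : realType} (disp : measure_display) (Omega : measurableType disp).
Variable P : probability Omega R.

Definition mutually_independent (I : finType)
    (F : I -> set (set Omega)) : Prop :=
  forall (J : {set I}) (A : I -> set Omega),
    (forall i, i \in J -> F i (A i)) ->
    P (\bigcap_(i in [set` J]) A i) = (\prod_(i in J) P (A i))%E.

End independence.

Section poisson.
Context {R : realType} (dispO dispT : measure_display).
Context {Omega : measurableType dispO} {T : measurableType dispT}.
Variables (P : probability Omega R) (n : {measure set T -> \bar R}).
Variable N : R.-ker Omega ~> T.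

(* The second argument of the library's [poisson_prob] is unused. *)
Definition poisson_random_measure : Prop :=
  [/\ forall A, measurable A -> (n A < +oo)%E -> forall k : nat,
        P [set w | N w A = k%:R%:E] = poisson_prob (fine (n A)) k [set k],
      forall A, measurable A -> n A = +oo%E ->
        P [set w | N w A = +oo%E] = 1%E
    & forall (k : nat) (A : 'I_k -> set T),
        (forall i, measurable (A i)) -> trivIset setT A ->
        mutually_independent P
          (fun i => preimage_set_system setT (N ^~ (A i)) measurable)].

Definition compensated_truncation (h : T -> R) (eps : R) (w : Omega) : R :=
  \int[N w]_(z in [set z | eps < `|h z|]) h z
  - \int[n]_(z in [set z | eps < `|h z|]) h z.

(* [Y] is a version of the integral of [h] with respect to the compensated
   measure N - n: the limit in probability, as eps decreases to 0, of the
   compensated integrals of h over {|h| > eps}, on which h is n-integrable. *)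
Definition is_compensated_integral (h : T -> R) (Y : Omega -> R) : Prop :=
  [/\ measurable_fun setT h,
      (\int[n]_z (Num.min `|h z| (h z ^+ 2))%:E < +oo)%E,
      measurable_fun setT Y
    & forall eta : R, 0 < eta ->
        P [set w | eta < `|Y w - compensated_truncation h eps w|]
          @[eps --> 0^'+] --> 0%E].

End poisson.

Section fields.
Context {R : realType} (I : Type) (D : set I).

Definition fdd_eq (disp1 disp2 : measure_display)
    (O1 : measurableType disp1) (P1 : probability O1 R) (X : I -> O1 -> R)
    (O2 : measurableType disp2) (P2 : probability O2 R) (Y : I -> O2 -> R) :
    Prop :=
  forall (k : nat) (t : 'I_k -> I), (forall i, D (t i)) ->
  forall A : set (k.-tuple R), measurable A ->
    P1 [set w | A [tuple X (t i) w | i < k]] =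
    P2 [set w | A [tuple Y (t i) w | i < k]].

Definition field_sigma_algebra (disp : measure_display)
    (Omega : measurableType disp) (X : I -> Omega -> R) : set (set Omega) :=
  <<s \bigcup_(i in D) preimage_set_system setT (X i) measurable >>.

Definition independent_copies (disp1 disp2 : measure_display)
    (O1 : measurableType disp1) (P1 : probability O1 R) (X : I -> O1 -> R)
    (O2 : measurableType disp2) (P2 : probability O2 R)
    (m : nat) (Xs : 'I_m -> I -> O2 -> R) : Prop :=
  [/\ forall i t, D t -> measurable_fun setT (Xs i t),
      forall i, fdd_eq P2 (Xs i) P1 X
    & mutually_independent P2 (fun i => field_sigma_algebra (Xs i))].

End fields.

Section random_balls.
Context {R : realType} {d : nat}.

Definition ball_integrand (mu : signed_measure R d)
    (z : ball_space R d) : R :=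
  z.2 * fine (mu (eucl_ball z.1.1 z.1.2)).

End random_balls.

(* Main.v *)
(** In law, a compensated Poisson integral depends only on the intensity and the
    integrand: the law of a Poisson random measure is determined by its
    intensity, compensated truncations are measurable functions of the random
    measure, and the limit in probability inherits the equality of laws.

    Let g be a similarity of ratio b and f its inverse. Since
    mu (g^-1 (B (x, r))) = mu (B (f x, r / b)), the variable J (g_* mu) is the
    compensated integral of the integrand of mu against the image of N under
    (x, r, m) |-> (f x, r / b, m), a Poisson random measure whose intensity is
    b^(d - beta) times that of N. This factor is 1 for isometries. For
    b = m^(1 / (d - beta)) it is m, which is also the intensity of the
    superposition of m independent copies of N, built on a product probability
    space, against which the integral of the same integrand is a sum of m
    independent copies of J. *)

Require Import Defs.
From HB Require Import structures.
From mathcomp Require Import all_boot all_order all_algebra.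
From mathcomp Require Import complex.
From mathcomp Require Import all_classical all_reals all_analysis.
From mathcomp Require Import interval_inference measurable_realfun.
From mathcomp Require Import ring.

Set Implicit Arguments.
Unset Strict Implicit.
Unset Printing Implicit Defensive.

Import Order.TTheory GRing.Theory Num.Theory.
Import numFieldNormedType.Exports.

Local Open Scope classical_set_scope.
Local Open Scope ring_scope.

(** Two obstacles shape the proof. A Poisson random measure is specified only on disjoint sets, and
    the fields to be compared live on unrelated probability spaces. So N is viewed as a random
    element of the space of measures with the evaluation sigma-algebra; its law is fixed by
    cylinders, and a finite family of sets is cut into disjoint atoms. Limits in probability are
    then compared on orthants {c_i <= Y_i}, which merely shift when Y is perturbed. Secondly,
    truncated integrals become real numbers through [fine], which is additive on finite values only.
    Images raise no difficulty, as the change of variables holds for every measurable function.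
    Superpositions do: integrability of h on {|h| > eps} with respect to N w must first be shown
    almost surely, from the fact that the intensity of {|h| > j} tends to 0. The given copies of J
    come without a Poisson measure. They are matched with the constructed copies through the
    probabilities of boxes, which determine the law of the sum. Measurability of (x, r) -> mu (B (x,
    r)) is supplied by the assumption that J mu is a compensated integral. *)

Lemma measurable_preimage d1 d2 (T1 : measurableType d1)
    (T2 : measurableType d2) (f : T1 -> T2) (B : set T2) :
  measurable_fun setT f -> measurable B -> measurable (f @^-1` B).
Proof. by move=> mf mB; rewrite -[X in measurable X]setTI; exact: mf. Qed.

Definition mpushforward d1 d2 (T1 : measurableType d1)
    (T2 : measurableType d2) (R : realType) (f : T1 -> T2)
    (mf : measurable_fun setT f) (m : {measure set T1 -> \bar R}) :
    {measure set T2 -> \bar R} :=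
  measure_function_pushforward__canonical__measure_function_Measure m mf.

(** * Generating classes: boxes of tuples and independence *)

Section tuple_boxes.
Context {d : measure_display} {T : measurableType d} {k : nat}.
Implicit Types E : 'I_k -> set T.

Definition tuple_box E : set (k.-tuple T) :=
  [set x | forall i, E i (tnth x i)].

Lemma measurable_forall d' (S : measurableType d') (A : 'I_k -> set S) :
  (forall i, measurable (A i)) -> measurable [set x | forall i, A i x].
Proof.
move=> mA; rewrite (_ : [set _ | _] = \big[setI/setT]_(i < k) A i).
  exact: bigsetI_measurable.
apply/seteqP; split => x /=; first by move=> Ax; elim/big_ind: _.
by move=> + i; rewrite (bigD1 i)//= => -[].
Qed.

Lemma measurable_tuple_box E :
  (forall i, measurable (E i)) -> measurable (tuple_box E).
Proof.
move=> mE; apply: measurable_forall => i.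
exact: measurable_preimage (@measurable_tnth _ _ _ i) (mE i).
Qed.

Variable G : set (set T).
Hypotheses (mG : measurable = <<s G >>) (GI : setI_closed G) (GT : G setT).

Definition tuple_boxes : set (set (k.-tuple T)) :=
  [set tuple_box E | E in [set E | forall i, G (E i)]].

Let mGs A : G A -> measurable A.
Proof. by move=> GA; rewrite mG; exact: sub_sigma_algebra. Qed.

Lemma tuple_boxes_setT : tuple_boxes setT.
Proof. by exists (fun=> setT) => //; apply/seteqP. Qed.

Lemma measurable_tuple_boxes : measurable = <<s tuple_boxes >>.
Proof.
apply/seteqP; split; last first.
  apply: smallest_sub; first exact: sigma_algebra_measurable.
  by move=> _ [E GE <-]; apply: measurable_tuple_box => i; exact: mGs.
apply: smallest_sub; first exact: smallest_sigma_algebra.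
(* The sigma-algebra of tuples is generated by a finite union of systems of coordinate preimages, so
   one coordinate at a time suffices. The preimage of a generator is a box with [setT] in all other
   slots, which is where [GT] enters. *)
elim/big_ind: _ => // [F F' FH FH' A [/FH|/FH']|i _ _ [B mB <-]] //.
rewrite setTI.
have mt : measurable_fun [set: g_sigma_algebraType tuple_boxes]
    (fun x : k.-tuple T => tnth x i).
  apply: (measurability G) => // _ [C GC <-]; rewrite setTI.
  apply: sub_sigma_algebra.
  exists (fun j => if j == i then C else setT) => [j /=|].
    by case: ifP.
  apply/seteqP; split=> x /=; first by move=> /(_ i); rewrite eqxx.
  by move=> Cx j; case: ifPn => // /eqP ->.
exact: (@measurable_preimage _ _ (g_sigma_algebraType tuple_boxes) _ _ B mt mB).
Qed.

Lemma setI_closed_tuple_boxes : setI_closed tuple_boxes.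
Proof.
move=> _ _ [E GE <-] [F GF <-]; exists (fun i => E i `&` F i) => [i|].
  exact: GI.
apply/seteqP; split => x /=; first by move=> EF; split=> i; have [] := EF i.
by move=> [EX FX] i; split; [exact: EX|exact: FX].
Qed.

(** Boxes form a generating pi-system. The class [G] of sides is left free: it will be all
    measurable sets for Poisson counts, and the closed upper rays for limits in probability. *)
Lemma tuple_measure_unique (R : realType)
    (m1 m2 : {measure set (k.-tuple T) -> \bar R}) :
  (m1 setT < +oo)%E ->
  (forall E, (forall i, G (E i)) -> m1 (tuple_box E) = m2 (tuple_box E)) ->
  forall A, measurable A -> m1 A = m2 A.
Proof.
move=> m1T m12.
apply: (measure_unique tuple_boxes (fun=> setT)) => //.
- exact: measurable_tuple_boxes.
- exact: setI_closed_tuple_boxes.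
- by move=> _; exact: tuple_boxes_setT.
- by rewrite bigcup_const.
- by move=> _ [E GE <-]; exact: m12.
Qed.

End tuple_boxes.

Lemma prod_probability_fine (I : finType) (D : pred I) d (T : measurableType d)
    (R : realType) (P : probability T R) (A : I -> set T) :
  (forall i, measurable (A i)) ->
  (\prod_(i | D i) P (A i) = (\prod_(i | D i) fine (P (A i)))%:E)%E.
Proof.
move=> mA; rewrite -prodEFin; apply: eq_bigr => i _.
by rewrite fineK// fin_num_measure.
Qed.

Section independence_generation.
Context {d d' : measure_display} {Omega : measurableType d}
  {T : measurableType d'} {R : realType} {k : nat}.
Variables (P : probability Omega R) (X : 'I_k -> Omega -> T).
Hypothesis mX : forall i, measurable_fun setT (X i).
Variable G : set (set T).
Hypotheses (mG : measurable = <<s G >>) (GI : setI_closed G) (GT : G setT).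
Implicit Types E : 'I_k -> set T.

Let indep E := P [set w | forall i, E i (X i w)] =
  (\prod_(i < k) P (X i @^-1` E i))%E.

Lemma independent_generation :
  (forall E, (forall i, G (E i)) -> indep E) ->
  forall E, (forall i, measurable (E i)) -> indep E.
Proof.
move=> indepG E mE.
have mGs A : G A -> measurable A.
  by move=> GA; rewrite mG; exact: sub_sigma_algebra.
(* The generators are replaced by measurable sets one coordinate at a time. *)
suff: forall l E, (l <= k)%N -> (forall i, measurable (E i)) ->
    (forall i : 'I_k, (l <= i)%N -> G (E i)) -> indep E.
  by move=> /(_ k); apply => // i; rewrite leqNgt ltn_ord.
elim=> [|l IH] {mE}E lk mE GE; first by apply: indepG => i; exact: GE.
pose i0 := Ordinal lk.
pose upd B i := if i == i0 then B else E i.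
have updE : E = upd (E i0).
  by apply/funext => i; rewrite /upd; case: eqP => // ->.
pose C := [set w | forall i, i != i0 -> E i (X i w)].
have mC : measurable C.
  rewrite (_ : C = [set w | forall i,
      (if i == i0 then setT else X i @^-1` E i) w]).
    apply: measurable_forall => i; case: ifP => // _.
    exact: measurable_preimage.
  apply/seteqP; split => w Cw i /=; last by move=> /negbTE ii0; have := Cw i;
    rewrite ii0.
  by case: ifPn => // /Cw.
have LE B : [set w | forall i, upd B i (X i w)] = X i0 @^-1` B `&` C.
  apply/seteqP; split => w /=.
    move=> h; split; first by have := h i0; rewrite /upd eqxx.
    by move=> i /negbTE ii0; have := h i; rewrite /upd ii0.
  by move=> [? h] i; rewrite /upd; case: ifPn => [/eqP->//|/h].
pose c := \prod_(i | i != i0) fine (P (X i @^-1` E i)).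
have c0 : 0 <= c by apply: prodr_ge0 => i _; rewrite fine_ge0.
have RE B : measurable B ->
    (\prod_(i < k) P (X i @^-1` upd B i) = c%:E * P (X i0 @^-1` B))%E.
  move=> mB; rewrite (bigD1 i0)//= {1}/upd eqxx muleC; congr (_ * _)%E.
  rewrite /c -prod_probability_fine; last first.
    by move=> i; exact: measurable_preimage.
  by apply: eq_bigr => i /negbTE; rewrite /upd => ->.
(* With the other coordinates frozen, both sides of the independence identity are finite measures in
   the set [B] of coordinate [i0]: the law of [X i0] restricted to the event [C], and [c] times the
   law of [X i0]. The induction hypothesis makes them agree on [G], hence everywhere. *)
pose m1 := mpushforward (mX i0) (mrestr P mC).
pose m2 := mscale (NngNum c0) (mpushforward (mX i0) P).
rewrite /indep updE LE RE//.
apply: (@measure_unique _ _ _ G (fun=> setT) mG GI _ _ m1 m2) => //.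
- by rewrite bigcup_const.
- move=> B GB; rewrite /m1 /m2 /= /pushforward /mrestr -LE.
  apply: etrans (RE _ (mGs _ GB)); apply: IH; first exact: ltnW.
    by move=> i; rewrite /upd; case: ifP => // _; exact: mGs.
  move=> i li; rewrite /upd; case: ifPn => // ii0; apply: GE.
  by rewrite ltn_neqAle li andbT; apply: contra ii0 => /eqP il;
    exact/eqP/val_inj.
- move=> _; rewrite /m1 /= /pushforward /mrestr preimage_setT setTI.
  by rewrite (le_lt_trans (probability_le1 _ _)) ?ltry.
Qed.

End independence_generation.

(** * The law of a Poisson random measure *)

Section evaluation_space.
Context (d : measure_display) (T : measurableType d) (R : realType).

(** A named copy of the type of measures, pointed by the null measure, so that it can carry a
    generated sigma-algebra: it is the state space in which a random measure takes its values. *)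
Definition mspace : Type := {measure set T -> \bar R}.

HB.instance Definition _ := gen_eqMixin mspace.
HB.instance Definition _ := gen_choiceMixin mspace.
HB.instance Definition _ := isPointed.Build mspace mzero.

(** The families are indexed by [nat] and read only below [k], so that intersecting two cylinders
    amounts to concatenating index ranges, without dependent types. *)
Definition cylinders : set (set mspace) :=
  [set C | exists (k : nat) (A : nat -> set T) (E : nat -> set (\bar R)),
    [/\ forall i, measurable (A i), forall i, measurable (E i) &
      C = [set m : mspace | forall i, (i < k)%N ->
        E i ((m : {measure set T -> \bar R}) (A i))]]].

Definition mspaceM := g_sigma_algebraType cylinders.

Lemma setI_closed_cylinders : setI_closed cylinders.
Proof.
move=> _ _ [k [A [E [mA mE ->]]]] [l [B [F [mB mF ->]]]].
exists (k + l)%N, (fun i => if (i < k)%N then A i else B (i - k)%N),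
  (fun i => if (i < k)%N then E i else F (i - k)%N); split.
- by move=> i; case: ifP.
- by move=> i; case: ifP.
apply/seteqP; split => m /=.
  move=> [mk ml] i ikl; case: ifPn => [/mk//|]; rewrite -leqNgt => ki.
  by apply: ml; rewrite ltn_subLR.
move=> h; split => i ii; first by have := h i (ltn_addr _ ii); rewrite ii.
have := h (k + i)%N; rewrite ltn_add2l ii => /(_ isT).
by rewrite ltnNge leq_addr/= addKn.
Qed.

Lemma measurable_to_mspace d' (O : measurableType d')
    (f : O -> {measure set T -> \bar R}) :
  (forall A, measurable A -> measurable_fun setT (f ^~ A)) ->
  @measurable_fun _ _ O mspaceM setT f.
Proof.
move=> mf; apply: (@measurability _ _ O mspaceM _ _ cylinders) => //.
move=> _ [_ [k [A [E [mA mE ->]]]] <-]; rewrite setTI.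
rewrite (_ : _ @^-1` _ = [set w | forall i : 'I_k, E i (f w (A i))]);
  last first.
  by apply/seteqP; split => [w /= h i|w /= h i ik];
    [exact: h|exact: (h (Ordinal ik))].
apply: measurable_forall => i.
exact: measurable_preimage (mf _ (mA i)) (mE i).
Qed.

Lemma measurable_evaluation (A : set T) : measurable A ->
  measurable_fun setT (fun m : mspaceM => (m : {measure set T -> \bar R}) A).
Proof.
move=> mA _ B mB; rewrite setTI; apply: sub_sigma_algebra.
exists 1%N, (fun=> A), (fun=> B); split => //.
by apply/seteqP; split => m /= => [Bm i _|/(_ 0%N)]; [|exact].
Qed.

End evaluation_space.

(** The form in which almost sure arguments are run: two events only have to agree on a set of full
    measure. *)
Lemma measure_eq_on d (T : measurableType d) (R : realType)
    (m : {measure set T -> \bar R}) (S A B : set T) :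
  measurable S -> measurable A -> measurable B -> m (~` S) = 0%E ->
  A `&` S = B `&` S -> m A = m B.
Proof.
move=> mS mA mB mS0 AB.
have mC : measurable (~` S) by exact: measurableC.
have E C : measurable C -> m C = m (C `&` S).
  move=> mCC; rewrite (measureDI m mCC mS) -[RHS]add0e; congr (_ + _)%E.
  apply/eqP; rewrite eq_le measure_ge0 andbT -mS0 setDE le_measure ?inE//.
  exact: measurableI.
by rewrite (E A)// (E B)// AB.
Qed.

Section poisson_law.
Context {R : realType}.
Local Open Scope ereal_scope.

(** The Poisson law on the extended line, with the point mass at +oo as the law of infinite
    parameter; sets of finite and infinite intensity then obey one formula. *)
Definition poisson_law (x : \bar R) (E : set (\bar R)) : \bar R :=
  if x is r%:E then poisson_prob r 0 [set k : nat | E k%:R%:E]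
  else \d_(+oo : \bar R) E.

Context {dO : measure_display} {Omega : measurableType dO}.
Variable P : probability Omega R.

Lemma poisson_law_fin (X : Omega -> \bar R) (r : R) :
  measurable_fun setT X ->
  (forall k : nat, P [set w | X w = k%:R%:E] = poisson_prob r k [set k]) ->
  forall E, measurable E -> P (X @^-1` E) = poisson_law r%:E E.
Proof.
move=> mX PX E mE.
have mk (k : nat) : measurable [set w | X w = k%:R%:E].
  exact: measurable_preimage mX (emeasurable_set1 _).
have U (F : set nat) :
    P (\bigcup_(k in F) [set w | X w = k%:R%:E]) = poisson_prob r 0 F.
  transitivity (\sum_(0 <= k <oo | k \in F) P [set w | X w = k%:R%:E]).
    rewrite measure_bigcup//; apply/trivIsetP => i j _ _ ij.
    apply/seteqP; split => w //= [->] [] /eqP; rewrite eqr_nat.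
    exact/negP.
  rewrite (eq_eseriesr (g := fun k => poisson_prob r 0 [set k])); last first.
    by move=> k _; exact: PX.
  rewrite [in RHS](_ : F = \bigcup_(k in F) [set k]); last first.
    by apply/seteqP; split => [k Fk|k [l Fl ->]//]; exists k.
  rewrite (measure_bigcup (poisson_prob r 0))//.
  by apply/trivIsetP => i j _ _ ij; apply/seteqP; split => k //= [-> /eqP];
    exact/negP.
(* The prescribed point probabilities sum to 1, so [X] is almost surely a natural number and no
   other value contributes to an event {X in E}. *)
have PN : P (~` \bigcup_(k in setT) [set w | X w = k%:R%:E]) = 0.
  rewrite probability_setC; last exact: bigcup_measurable.
  by rewrite U probability_setT subee.
rewrite /poisson_law -U.
apply: (measure_eq_on
  (S := \bigcup_(k in setT) [set w | X w = k%:R%:E])) => //.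
- exact: bigcup_measurable.
- exact: measurable_preimage.
- exact: bigcup_measurable.
apply/seteqP; split => w /= [Ew [k _ Xk]]; split; try by exists k.
  by exists k => //=; rewrite -Xk.
by case: Ew => l /= El Xl; rewrite Xl.
Qed.

End poisson_law.

Lemma poisson_prob_set1 (R : realType) (r : R) (j k : nat) :
  poisson_prob r j [set k] = poisson_prob r 0 [set k].
Proof. by []. Qed.

Section poisson_random_measure_law.
Context {R : realType} {dO dT : measure_display}.
Context {Omega : measurableType dO} {T : measurableType dT}.
Variables (P : probability Omega R) (n : {measure set T -> \bar R}).
Variable N : R.-ker Omega ~> T.
Hypothesis hN : poisson_random_measure P n N.
Local Open Scope ereal_scope.

Lemma prm_law (A : set T) (E : set (\bar R)) : measurable A -> measurable E ->
  P ((N ^~ A) @^-1` E) = poisson_law (n A) E.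
Proof.
move=> mA mE; have [hfin hoo _] := hN.
have mNA : measurable_fun setT (N ^~ A) by exact: measurable_kernel.
have [nAoo|nAoo] := ltP (n A) +oo.
  have -> : n A = (fine (n A))%:E by rewrite fineK// ge0_fin_numE.
  by apply: poisson_law_fin => // k; exact: hfin.
have {}nAoo : n A = +oo by apply/eqP; rewrite -leye_eq.
rewrite nAoo /= diracE.
have mS : measurable [set w | N w A = +oo].
  exact: measurable_preimage mNA (emeasurable_set1 _).
have PS : P (~` [set w | N w A = +oo]) = 0.
  by rewrite probability_setC// hoo// subee.
have [ooE|ooE] := boolP (+oo \in E).
  rewrite -(probability_setT P); apply: (measure_eq_on mS) => //.
    exact: measurable_preimage.
  rewrite setTI; apply/setIidPr => w /= ->; exact: set_mem.
transitivity (P set0); last by rewrite measure0.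
apply: (measure_eq_on mS) => //; first exact: measurable_preimage.
rewrite set0I; apply/seteqP; split => // w [/= + Noo]; rewrite Noo => /mem_set.
exact/negP.
Qed.

Lemma prm_joint_law k (A : 'I_k -> set T) (E : 'I_k -> set (\bar R)) :
  (forall i, measurable (A i)) -> trivIset setT A ->
  (forall i, measurable (E i)) ->
  P [set w | forall i, E i (N w (A i))] =
  \prod_(i < k) poisson_law (n (A i)) (E i).
Proof.
move=> mA tA mE; have [_ _ indep] := hN.
have := indep k A mA tA [set: 'I_k]%SET (fun i => (N ^~ (A i)) @^-1` (E i)).
rewrite (_ : \bigcap_(i in _) _ = [set w | forall i, E i (N w (A i))]);
  last first.
  by apply/seteqP; split => w /= h i;
    [apply: h; rewrite /= inE|move=> _; exact: h].
move=> -> => [|i _].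
  by apply: eq_big => [i|i _]; [rewrite inE|exact: prm_law].
by exists (E i) => //; rewrite setTI.
Qed.

End poisson_random_measure_law.

Section atoms.
Context {R : realType} {dT : measure_display} {T : measurableType dT} {k : nat}.
Variable A : 'I_k -> set T.
Hypothesis mA : forall i, measurable (A i).

(** The atoms of the Boolean algebra generated by the [A i], one for each set of indices, some
    possibly empty. They are numbered by an ordinal because independence is stated for families
    indexed by ['I_k]. *)
Definition atom (j : 'I_#|{: {set 'I_k}}|) : set T :=
  [set x | forall i, if i \in enum_val j then A i x else ~ A i x].

Lemma measurable_atom j : measurable (atom j).
Proof.
apply: measurable_forall => i; case: (i \in _); first exact: mA.
exact: measurableC.
Qed.

Lemma trivIset_atom : trivIset setT atom.
Proof.
move=> i j _ _ [x [xi xj]]; apply: (can_inj enum_valK); apply/setP => l.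
by have := xi l; have := xj l; case: (l \in enum_val i);
  case: (l \in enum_val j).
Qed.

Lemma bigcup_atom i :
  A i = \big[setU/set0]_(j < #|{: {set 'I_k}}| | i \in enum_val j) atom j.
Proof.
apply/seteqP; split => x; last first.
  elim/big_ind: _ => // [F F' FH FH' [/FH|/FH']|j ij /(_ i)] //.
  by rewrite ij.
(* The atom containing [x] is indexed by the set of all [l] such that [x] lies in [A l]. *)
move=> Aix; pose j := enum_rank [set l | `[< A l x >]]%SET.
rewrite (bigD1 j) /=; last by rewrite enum_rankK inE; exact/asboolP.
left => l; rewrite enum_rankK inE; by case: asboolP.
Qed.

Lemma measure_atoms (m : {measure set T -> \bar R}) i :
  m (A i) = (\sum_(j < #|{: {set 'I_k}}| | i \in enum_val j) m (atom j))%E.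
Proof.
rewrite [in LHS]bigcup_atom measure_bigsetU_ord//; [|exact: trivIset_atom].
exact: measurable_atom.
Qed.

End atoms.

Section poisson_random_measure_unique.
Context {R : realType} {dO1 dO2 dT : measure_display}.
Context {O1 : measurableType dO1} {O2 : measurableType dO2}
  {T : measurableType dT}.
Variables (P1 : probability O1 R) (P2 : probability O2 R).
Variables (n1 n2 : {measure set T -> \bar R}).
Variables (N1 : R.-ker O1 ~> T) (N2 : R.-ker O2 ~> T).
Hypothesis n12 : forall A, measurable A -> n1 A = n2 A.
Hypotheses (hN1 : poisson_random_measure P1 n1 N1)
  (hN2 : poisson_random_measure P2 n2 N2).
Local Open Scope ereal_scope.

Let disjoint_eq k (A : 'I_k -> set T) (B : set (k.-tuple (\bar R))) :
  (forall i, measurable (A i)) -> trivIset setT A -> measurable B ->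
  P1 [set w | B [tuple N1 w (A i) | i < k]] =
  P2 [set w | B [tuple N2 w (A i) | i < k]].
Proof.
move=> mA tA mB.
have mN (dO : measure_display) (O : measurableType dO) (N : R.-ker O ~> T) :
    measurable_fun setT (fun w => [tuple N w (A i) | i < k]).
  apply/measurable_fun_tnthP => i; rewrite (_ : _ \o _ = N ^~ (A i)).
    exact: measurable_kernel.
  by apply/funext => w /=; rewrite tnth_mktuple.
apply: (@tuple_measure_unique _ _ _ measurable _ _ _ _
  (mpushforward (mN _ _ N1) P1)
  (mpushforward (mN _ _ N2) P2)) => //.
- by rewrite smallest_id//; exact: sigma_algebra_measurable.
- by move=> ? ?; exact: measurableI.
- by rewrite /= /pushforward preimage_setT probability_setT ltry.
move=> E mE; rewrite /= /pushforward.
have box dO (O : measurableType dO) (P : probability O R) n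
  (N : R.-ker O ~> T) :
    poisson_random_measure P n N ->
    P ((fun w => [tuple N w (A i) | i < k]) @^-1` tuple_box E) =
    \prod_(i < k) poisson_law (n (A i)) (E i).
  move=> hN; rewrite -(prm_joint_law hN)//; congr (P _).
  by apply/seteqP; split => w /= h i; have := h i; rewrite tnth_mktuple.
rewrite (box _ _ _ _ _ hN1) (box _ _ _ _ _ hN2).
by apply: eq_bigr => i _; rewrite n12.
Qed.

(** Values on arbitrary sets are finite sums of values on their disjoint atoms, where independence
    and the Poisson marginals give the joint law. This settles cylinders, which form a generating
    pi-system. *)
Lemma prm_unique (U : set (mspaceM T R)) : measurable U ->
  P1 [set w | U (N1 w)] = P2 [set w | U (N2 w)].
Proof.
have mN (dO : measure_display) (O : measurableType dO) (N : R.-ker O ~> T) :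
    @measurable_fun _ _ O (mspaceM T R) setT N.
  by apply: measurable_to_mspace => A mA; exact: measurable_kernel.
move: U; apply: (@measure_unique _ _ (mspaceM T R) (@cylinders _ T R)
  (fun=> setT) _ _ _ _
  (mpushforward (mN _ _ N1) P1)
  (mpushforward (mN _ _ N2) P2)) => //.
- exact: setI_closed_cylinders.
- move=> _; exists 0%N, (fun=> setT), (fun=> setT); split => //.
  by apply/seteqP.
- by rewrite bigcup_const.
- move=> _ [k [A [E [mA mE ->]]]]; rewrite /= /pushforward.
  pose A' (i : 'I_k) := A i.
  have mA' i : measurable (A' i) by exact: mA.
  (* The cylinder, rewritten as a condition on the vector of values at the atoms. *)
  pose B := [set x : #|{: {set 'I_k}}|.-tuple (\bar R) | forall i : 'I_k,
    E i (\sum_(j < #|{: {set 'I_k}}| | i \in enum_val j) tnth x j)].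
  have mB : measurable B.
    apply: measurable_forall => i; rewrite -[X in measurable X]setTI.
    have : measurable_fun setT (fun x : #|{: {set 'I_k}}|.-tuple (\bar R) =>
        \sum_(j < #|{: {set 'I_k}}| | i \in enum_val j) tnth x j).
      under eq_fun do rewrite -big_filter.
      apply: emeasurable_sum => j; exact: measurable_tnth.
    by apply.
  have BE (m : {measure set T -> \bar R}) :
     (forall i : nat, (i < k)%N -> E i (m (A i))) <->
       B [tuple m (atom A' j) | j < _].
    split => h i; last first.
      move=> ik; have := h (Ordinal ik); under eq_bigr do rewrite tnth_mktuple.
      by rewrite -measure_atoms.
    under eq_bigr do rewrite tnth_mktuple.
    by rewrite -measure_atoms//; exact: h.
  have setE (dO : measure_display) (O : measurableType dO) (N : R.-ker O ~> T) :
    (N : O -> mspaceM T R) @^-1` [set m : mspaceM T R | forall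
      i, (i < k)%N -> E i ((m : {measure set T -> \bar R}) (A i))]
    = [set w | B [tuple N w (atom A' j) | j < _]].
    by apply/seteqP; split => w /= /BE.
  rewrite (setE _ _ N1) (setE _ _ N2); apply: disjoint_eq => //.
    exact: measurable_atom.
  exact: trivIset_atom.
- by move=> _; rewrite /= /pushforward preimage_setT probability_setT ltry.
Qed.

End poisson_random_measure_unique.

Lemma measure_exists_le d (T : measurableType d) (R : realType)
    (m : {measure set T -> \bar R}) k (A : 'I_k -> set T) :
  (forall i, measurable (A i)) ->
  measurable [set w | exists i, A i w] /\
  (m [set w | exists i, A i w] <= \sum_(i < k) m (A i))%E.
Proof.
move=> mA; have -> : [set w | exists i, A i w] = \big[setU/set0]_(i < k) A i.
  apply/seteqP; split => w /=; first by move=> [i Ai]; rewrite (bigD1 i)//;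
    left.
  by elim/big_ind: _ => // [F F' FF FF' [/FF|/FF']|i _ Aiw]//; exists i.
elim/big_rec2: _ => [|i y X _ [mX IH]]; first by rewrite measure0.
split; first exact: measurableU.
by apply: (le_trans (measureU2 m (mA i) mX)); exact: leeD2l.
Qed.

(** * Equality in law of compensated integrals on different probability spaces *)

Section compensated_uniqueness.
Context {R : realType} {dT : measure_display} {T : measurableType dT}.

Lemma measurable_exceedance (h : T -> R) (eps : R) :
  measurable_fun setT h -> measurable [set z | eps < `|h z|].
Proof.
move=> mh; rewrite -[X in measurable X]setTI; apply: measurable_fun_ltr => //.
exact: measurableT_comp.
Qed.

(** Integrals of the positive and negative parts depend measurably on the measure, evaluation being
    a kernel. As [fine] is total and measurable, measures for which [h] is not integrable are
    covered as well. *)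
Lemma measurable_integral_mspace (h : T -> R) (D : set T) :
  measurable_fun setT h -> measurable D ->
  measurable_fun setT
    (fun m : mspaceM T R => (\int[m : {measure set T -> \bar R}]_(z in D) h
      z)%R).
Proof.
move=> mh mD; rewrite /Rintegral.
have mhD : measurable_fun setT ((EFin \o h) \_ D).
  apply/(measurable_restrictT _ mD); apply: measurable_funTS.
  exact/measurable_EFinP.
apply: (@measurableT_comp _ _ _ _ _ _ fine) => //.
under eq_fun do rewrite integral_mkcond integralE.
by apply: emeasurable_funB; apply: measurable_fun_integral_kernel => //;
  solve [exact: measurable_evaluation|exact: measurable_funepos|
    exact: measurable_funeneg].
Qed.

(** Closed rays, because lowering the endpoint absorbs a small perturbation of the variable. The
    endpoint is an extended real so that the whole line is a ray, as required for boxes. *)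
Definition upper_rays : set (set R) :=
  [set [set x | (c <= x%:E)%E] | c in [set: \bar R]].

Lemma measurable_upper_rays : measurable = <<s upper_rays >>.
Proof.
apply/seteqP; split; last first.
  apply: smallest_sub; first exact: sigma_algebra_measurable.
  move=> _ [[c| |] _ <-].
  - rewrite (_ : mkset _ = `[c, +oo[%classic)//.
    by apply/seteqP; split => y /=; rewrite lee_fin in_itv/= andbT.
  - by rewrite (_ : mkset _ = set0)//; apply/seteqP; split => y.
  - by rewrite (_ : mkset _ = setT)//; apply/seteqP; split => y //= _;
    rewrite leNye.
rewrite (_ : measurable = <<s @RGenCInfty.G R >>);
  last exact: RGenCInfty.measurableE.
apply: smallest_sub; first exact: smallest_sigma_algebra.
apply: subset_trans; last exact: sub_sigma_algebra.
move=> _ [x ->]; exists x%:E => //.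
by apply/seteqP; split => y /=; rewrite lee_fin in_itv/= andbT.
Qed.

Lemma setI_closed_upper_rays : setI_closed upper_rays.
Proof.
move=> _ _ [a _ <-] [b _ <-]; exists (maxe a b) => //.
by apply/seteqP; split => x /=; rewrite ge_max => /andP.
Qed.

Lemma measurable_compensated_truncation dO (O : measurableType dO)
    (n : {measure set T -> \bar R}) (N : R.-ker O ~> T) (h : T -> R) eps :
  measurable_fun setT h -> measurable_fun setT
    (compensated_truncation n N h eps).
Proof.
move=> mh; apply: measurable_funB => //.
have mD := measurable_exceedance eps mh.
have mN : @measurable_fun _ _ O (mspaceM T R) setT N.
  by apply: measurable_to_mspace => A mA; exact: measurable_kernel.
exact: (measurableT_comp (measurable_integral_mspace mh mD) mN).
Qed.

End compensated_uniqueness.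

Section compensated_integral_law.
Context {R : realType} {dT : measure_display} {T : measurableType dT}.
Context {k : nat} (h : 'I_k -> T -> R).

Let upper (dO : measure_display) (O : measurableType dO) (Y : 'I_k -> O -> R)
  (c : 'I_k -> \bar R) := [set w | forall i, (c i <= (Y i w)%:E)%E].

Let measurable_upper dO (O : measurableType dO) (Y : 'I_k -> O -> R) c :
  (forall i, measurable_fun setT (Y i)) -> measurable (upper Y c).
Proof.
move=> mY; apply: measurable_forall => i.
apply: (measurable_preimage (B := [set x | (c i <= x%:E)%E]) (mY i)).
rewrite measurable_upper_rays; apply: sub_sigma_algebra; by exists (c i).
Qed.

Let bad (dO : measure_display) (O : measurableType dO) (P : probability O R)
  (eta : R) (Y Z : 'I_k -> O -> R) : \bar R :=
  (\sum_(i < k) P [set w | (eta < `|Y i w - Z i w|)%R])%E.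

(** Off the event that some coordinate of [Y] and [Z] differs by more than [eta], lowering every
    endpoint by [eta] carries the orthant event of [Y] into that of [Z]. A union bound controls the
    exceptional event. *)
Let upper_approx dO (O : measurableType dO) (P : probability O R)
    (Y Z : 'I_k -> O -> R) (c : 'I_k -> \bar R) (eta : R) :
  (forall i, measurable_fun setT (Y i)) ->
  (forall i, measurable_fun setT (Z i)) ->
  (P (upper Y c) <= P (upper Z (fun i => c i - eta%:E)) + bad P eta Y Z)%E.
Proof.
move=> mY mZ.
pose B i := [set w | eta < `|Y i w - Z i w|].
have mB i : measurable (B i).
  rewrite -[X in measurable X]setTI; apply: measurable_fun_ltr => //.
  by apply: measurableT_comp => //; exact: measurable_funB.
have [mex Pex] := measure_exists_le P mB.
have mU := measurable_upper (fun i => c i - eta%:E)%E mZ.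
apply: (@le_trans _ _ (P (upper Z (fun i => c i - eta%:E)%E `|`
  [set w | exists i, B i w]))).
  rewrite le_measure ?inE//; [exact: measurable_upper|exact: measurableU|].
  move=> w Yw; have [bw|bw] := pselect (exists i, B i w); [by right|left].
  move=> i; have := Yw i; have /negP : ~ B i w by move=> ?; apply: bw; exists i.
  rewrite -leNgt leeBlDr// -EFinD => YZi /le_trans; apply.
  rewrite lee_fin -lerBlDl; exact: le_trans (ler_norm _) YZi.
by apply: (le_trans (measureU2 P mU mex)); apply: leeD2l.
Qed.

Let bad_cvg dO (O : measurableType dO) (P : probability O R) n
    (N : R.-ker O ~> T) (Y : 'I_k -> O -> R) (eta : R) : 0 < eta ->
  (forall i, is_compensated_integral P n N (h i) (Y i)) ->
  bad P eta Y (fun i => compensated_truncation n N (h i) eps)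
    @[eps --> 0^'+] --> 0%E.
Proof.
move=> eta0 hY; rewrite [X in _ --> X](_ : _ = (\sum_(i < k) 0)%E); last first.
  by rewrite big1.
apply: cvg_nnesum => i _; first by near do exact: measure_ge0.
by have [_ _ _ /(_ _ eta0)] := hY i.
Unshelve. all: by end_near. Qed.

(** One inequality is enough, the hypotheses being symmetric in the two sides. The chain is Y1, its
    truncation, the equidistributed truncation on the other space, Y2; the first and last links each
    cost [eta]. For fixed [eta] the errors vanish as eps tends to 0, and only then does [eta] tend
    to 0. *)
Let upper_le (dO1 dO2 : measure_display)
  (O1 : measurableType dO1) (O2 : measurableType dO2)
  (P1 : probability O1 R) (P2 : probability O2 R)
  (n1 n2 : {measure set T -> \bar R})
  (N1 : R.-ker O1 ~> T) (N2 : R.-ker O2 ~> T)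
  (Y1 : 'I_k -> O1 -> R) (Y2 : 'I_k -> O2 -> R) (c : 'I_k -> \bar R) :
  (forall A, measurable A -> n1 A = n2 A) ->
  poisson_random_measure P1 n1 N1 -> poisson_random_measure P2 n2 N2 ->
  (forall i, is_compensated_integral P1 n1 N1 (h i) (Y1 i)) ->
  (forall i, is_compensated_integral P2 n2 N2 (h i) (Y2 i)) ->
  (P1 (upper Y1 c) <= P2 (upper Y2 c))%E.
Proof.
move=> n12 hN1 hN2 hY1 hY2.
have mY1 i : measurable_fun setT (Y1 i) by have [] := hY1 i.
have mY2 i : measurable_fun setT (Y2 i) by have [] := hY2 i.
have mh i : measurable_fun setT (h i) by have [] := hY1 i.
have step eta : 0 < eta ->
    (P1 (upper Y1 c) <= P2 (upper Y2 (fun i => c i - (eta + eta)%:E)))%E.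
  move=> eta0.
  pose Z1 eps i := compensated_truncation n1 N1 (h i) eps.
  pose Z2 eps i := compensated_truncation n2 N2 (h i) eps.
  have bound eps : (P1 (upper Y1 c) <=
    P2 (upper Y2 (fun i => c i - (eta + eta)%:E)) +
      (bad P1 eta Y1 (Z1 eps) + bad P2 eta Y2 (Z2 eps)))%E.
    have mZ1 i : measurable_fun setT (Z1 eps i)
      by exact: measurable_compensated_truncation.
    have mZ2 i : measurable_fun setT (Z2 eps i)
      by exact: measurable_compensated_truncation.
    apply: (le_trans (upper_approx P1 c eta mY1 mZ1)).
    rewrite [X in (_ <= _ + X)%E]addeC addeA.
    apply: leeD2r.
    have -> : P1 (upper (Z1 eps) (fun i => c i - eta%:E)%E) =
              P2 (upper (Z2 eps) (fun i => c i - eta%:E)%E).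
      pose D i := [set z | eps < `|h i z|].
      have mD i : measurable (D i) by exact: measurable_exceedance.
      (* The orthant event of the truncations as a set of measures. Its compensators are computed
         with [n1]; they agree with those of [n2] since the intensities agree on measurable sets. *)
      pose U := [set m : mspaceM T R | forall i, (c i - eta%:E <=
        (\int[m : {measure set T -> \bar R}]_(z in D i) h i z
          - \int[n1]_(z in D i) h i z)%:E)%E].
      have mU : measurable U.
        apply: (measurable_forall (S := mspaceM T R)) => i.
        apply: (@measurable_preimage _ _ (mspaceM T R) _ _
          [set x : R | (c i - eta%:E <= x%:E)%E]).
          by apply: measurable_funB => //; exact: measurable_integral_mspace.
        rewrite measurable_upper_rays; apply: sub_sigma_algebra.
        by exists (c i - eta%:E)%E.
      rewrite -[LHS]/(P1 [set w | U (N1 w)]) (prm_unique n12 hN1 hN2 mU).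
      congr (P2 _); rewrite /upper /U /= /Z2 /compensated_truncation.
      apply/seteqP; split => w /= + i => /(_ i); congr (_ <= _%:E)%E;
        congr (_ - _); rewrite /Rintegral; congr fine;
        apply: eq_measure_integral => A mA _; by rewrite n12.
    apply: le_trans (upper_approx P2 _ eta mZ2 mY2) _.
    rewrite {1}/bad; under eq_bigr do under eq_set do rewrite distrC.
    apply: leeD2r; rewrite le_eqVlt; apply/orP; left; apply/eqP.
    congr (P2 (upper _ _)); apply/funext => i.
    by rewrite EFinD oppeD// addeA.
  have cvgb : (P2 (upper Y2 (fun i => c i - (eta + eta)%:E)) +
      (bad P1 eta Y1 (Z1 eps) + bad P2 eta Y2 (Z2 eps)))%E @[eps --> 0^'+] -->
      (P2 (upper Y2 (fun i => c i - (eta + eta)%:E)) + (0 + 0))%E.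
    apply: cvgeD => //; first by rewrite add0e fin_num_adde_defl.
      exact: cvg_cst.
    by apply: cvgeD => //; exact: bad_cvg.
  rewrite -[leRHS]adde0 -[X in (_ + X)%E]adde0.
  by apply: cvge_ge cvgb; near do exact: bound.
(* Take [eta] to be 1/(j+1). Since the rays are closed, these orthants decrease exactly to the
   orthant at [c], and continuity from above concludes. *)
pose F j := upper Y2 (fun i => c i - (j.+1%:R^-1 + j.+1%:R^-1)%:E)%E.
have mF j : measurable (F j) by exact: measurable_upper.
have FE : \bigcap_j F j = upper Y2 c.
  apply/seteqP; split => w.
    move=> Fw i; apply/lee_addgt0Pr => e e0.
    have e20 : 0 < e / 2 by rewrite divr_gt0.
    near \oo => j; have := Fw j I i; rewrite leeBlDr// => /le_trans; apply.
    have je : j.+1%:R^-1 < e / 2.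
      by near: j; exact: (near_infty_natSinv_lt (PosNum e20)).
    by rewrite leeD2l// lee_fin [leRHS]splitr lerD// ltW.
  move=> cw j _ i; rewrite leeBlDr//; apply: le_trans (cw i) _.
  by rewrite leeDl// lee_fin addr_ge0.
rewrite -FE.
have : P2 (F j) @[j --> \oo] --> P2 (\bigcap_j F j).
  apply: nonincreasing_cvg_mu => //.
  - exact: le_lt_trans (probability_le1 _ _) (ltry _).
  - by rewrite FE; exact: measurable_upper.
  - move=> a b ab; apply/subsetPset => w Fw i; apply: le_trans (Fw i).
    rewrite leeB// lee_fin lerD// lef_pV2 ?posrE// ler_nat ltnS//.
by apply: cvge_ge; near do exact: step.
Unshelve. all: by end_near. Qed.

Context {dO1 dO2 : measure_display}.
Context {O1 : measurableType dO1} {O2 : measurableType dO2}.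
Variables (P1 : probability O1 R) (P2 : probability O2 R).
Variables (n1 n2 : {measure set T -> \bar R}).
Variables (N1 : R.-ker O1 ~> T) (N2 : R.-ker O2 ~> T).
Variables (Y1 : 'I_k -> O1 -> R) (Y2 : 'I_k -> O2 -> R).

Lemma compensated_integral_unique (A : set (k.-tuple R)) :
  (forall A, measurable A -> n1 A = n2 A) ->
  poisson_random_measure P1 n1 N1 -> poisson_random_measure P2 n2 N2 ->
  (forall i, is_compensated_integral P1 n1 N1 (h i) (Y1 i)) ->
  (forall i, is_compensated_integral P2 n2 N2 (h i) (Y2 i)) ->
  measurable A ->
  P1 [set w | A [tuple Y1 i w | i < k]] = P2 [set w | A [tuple Y2 i w | i < k]].
Proof.
move=> n12 hN1 hN2 hY1 hY2 mA.
have mt (dO : measure_display) (O : measurableType dO) (P : probability O R) n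
    (N : R.-ker O ~> T) (Y : 'I_k -> O -> R) :
    (forall i, is_compensated_integral P n N (h i) (Y i)) ->
    measurable_fun setT (fun w => [tuple Y i w | i < k]).
  move=> hY; apply/measurable_fun_tnthP => i; rewrite (_ : _ \o _ = Y i).
    by have [] := hY i.
  by apply/funext => w /=; rewrite tnth_mktuple.
have m1 := mt _ _ _ _ _ _ hY1; have m2 := mt _ _ _ _ _ _ hY2.
apply: (tuple_measure_unique (@measurable_upper_rays R)
  (@setI_closed_upper_rays R) _
  (m1 := mpushforward m1 P1)
  (m2 := mpushforward m2 P2)) => //.
- by exists -oo%E => //; apply/seteqP; split => x //= _; rewrite leNye.
- by rewrite /= /pushforward preimage_setT probability_setT ltry.
move=> E /= GE; rewrite /pushforward.
pose c i := sval (cid2 (GE i)).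
have cE i : [set x | (c i <= x%:E)%E] = E i by rewrite /c; case: cid2.
have box (O : Type) (Y : 'I_k -> O -> R) :
    (fun w => [tuple Y i w | i < k]) @^-1` tuple_box E =
    [set w | forall i, (c i <= (Y i w)%:E)%E].
  apply/seteqP; split => w /= h' i; have := h' i; rewrite tnth_mktuple -cE//.
rewrite !box; apply/eqP; rewrite eq_le; apply/andP; split.
  exact: upper_le n12 hN1 hN2 hY1 hY2.
by apply: upper_le hN2 hN1 hY2 hY1 => B mB; rewrite n12.
Qed.

End compensated_integral_law.

(** * Images and superpositions of Poisson random measures *)

Section kernel_pushforward.
Context {R : realType} {dO d1 d2 : measure_display}.
Context {O : measurableType dO} {T1 : measurableType d1}
  {T2 : measurableType d2}.
Variables (f : T1 -> T2) (mf : measurable_fun setT f).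

Lemma ge0_integral_mpushforward (m : {measure set T1 -> \bar R}) (D : set T2)
    (h : T2 -> \bar R) :
  measurable D -> measurable_fun setT h -> (forall y, 0 <= h y)%E ->
  (\int[mpushforward mf m]_(y in D) h y = \int[m]_(x in f @^-1` D) h (f x))%E.
Proof.
by move=> mD mh h0; apply: ge0_integral_pushforward => //;
  exact: measurable_funTS.
Qed.

(** Positive and negative parts are transported separately, so no integrability is asked. Hence the
    identity applies to N w for every w, including those where [h] is not integrable. *)
Lemma integral_mpushforward (m : {measure set T1 -> \bar R}) (D : set T2)
    (h : T2 -> \bar R) :
  measurable D -> measurable_fun setT h ->
  (\int[mpushforward mf m]_(y in D) h y = \int[m]_(x in f @^-1` D) h (f x))%E.
Proof.
move=> mD mh; rewrite [LHS]integralE [RHS]integralE.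
have H1 := ge0_integral_mpushforward m mD (measurable_funepos mh)
  (funepos_ge0 h).
have H2 := ge0_integral_mpushforward m mD (measurable_funeneg mh)
  (funeneg_ge0 h).
rewrite -[fun x => h (f x)]/(h \o f) (funepos_comp h f) (funeneg_comp h f).
by rewrite H1 H2.
Qed.

Variable N : R.-ker O ~> T1.

Definition kpushforward (w : O) : {measure set T2 -> \bar R} :=
  mpushforward mf (N w).

Lemma measurable_kpushforward (A : set T2) : measurable A ->
  measurable_fun setT (kpushforward ^~ A).
Proof.
by move=> mA; apply: (measurable_kernel N); exact: measurable_preimage.
Qed.

HB.instance Definition _ :=
  isKernel.Build _ _ _ _ R kpushforward measurable_kpushforward.

Variables (P : probability O R) (n : {measure set T1 -> \bar R}).

Lemma prm_pushforward : poisson_random_measure P n N ->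
  poisson_random_measure P (mpushforward mf n) kpushforward.
Proof.
move=> [hfin hoo hind].
have mpre B : measurable B -> measurable (f @^-1` B)
  by exact: measurable_preimage.
split.
- by move=> A mA; exact: hfin (mpre _ mA).
- by move=> A mA; exact: hoo (mpre _ mA).
move=> k A mA tA; apply: (hind k (fun i => f @^-1` A i)) => [i|].
  exact: mpre.
move=> i j _ _ [x [xi xj]]; apply: tA => //; by exists (f x).
Qed.

(** The set {|h| > eps} pulls back to {|h o f| > eps}, so the two truncations coincide for every
    outcome and every eps, and the same [Y] serves both. *)
Lemma compensated_integral_pushforward (h : T2 -> R) (Y : O -> R) :
  measurable_fun setT h ->
  is_compensated_integral P n N (h \o f) Y ->
  is_compensated_integral P (mpushforward mf n) kpushforward h Y.
Proof.
move=> mh [mhf hfin mY hcvg]; split => //.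
  rewrite ge0_integral_mpushforward//.
    apply/measurable_EFinP; apply: measurable_minr; last exact: measurable_funX.
    exact: measurableT_comp.
  by move=> y; rewrite lee_fin le_min normr_ge0 sqr_ge0.
move=> eta eta0; rewrite (_ : (fun=> _) = fun eps =>
    P [set w | eta < `|Y w - compensated_truncation n N (h \o f) eps w|]).
  exact: hcvg.
apply/funext => eps; congr (P _).
have mD := measurable_exceedance eps mh.
have mh' : measurable_fun setT (EFin \o h) by exact/measurable_EFinP.
rewrite /compensated_truncation /Rintegral.
by apply/seteqP; split => w /=; rewrite !integral_mpushforward.
Qed.

End kernel_pushforward.

(** Subfamilies in the definition of independence are absorbed by putting [setT] at the missing
    indices. *)
Lemma mutually_independent_preimageP d d' (O : measurableType d)
    (T : measurableType d') (R : realType) (P : probability O R) k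
    (Z : 'I_k -> O -> T) :
  (forall i, measurable_fun setT (Z i)) ->
  mutually_independent P (fun i => preimage_set_system setT (Z i) measurable)
    <->
  (forall E : 'I_k -> set T, (forall i, measurable (E i)) ->
    P [set w | forall i, E i (Z i w)] = (\prod_(i < k) P (Z i @^-1` E i))%E).
Proof.
move=> mZ; split => [indep E mE|indep J A AZ].
  have := indep [set: 'I_k]%SET (fun i => Z i @^-1` E i).
  rewrite (_ : \bigcap_(i in _) _ = [set w | forall i, E i (Z i w)]);
    last first.
    by apply/seteqP; split => w /= h i;
      [apply: h; rewrite /= inE|move=> _; exact: h].
  move=> -> => [|i _]; last by exists (E i) => //; rewrite setTI.
  by apply: eq_bigl => i; rewrite inE.
have /choice[E EP] : forall i, exists E, [/\ measurable E,
    i \in J -> Z i @^-1` E = A i & i \notin J -> E = setT].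
  move=> i; have [iJ|iJ] := boolP (i \in J); last by exists setT; split.
  by have [E mE <-] := AZ i iJ; exists E; rewrite setTI.
have mE i : measurable (E i) by have [] := EP i.
have EA i : i \in J -> Z i @^-1` E i = A i by have [] := EP i.
have ET i : i \notin J -> E i = setT by have [] := EP i.
have := indep E mE.
rewrite (_ : [set _ | _] = \bigcap_(i in [set` J]) A i); last first.
  apply/seteqP; split => w /= h i.
    by move=> /= iJ; rewrite -EA//; exact: h.
  have [iJ|iJ] := boolP (i \in J); last by rewrite ET.
  by have := h i iJ; rewrite -EA.
move=> ->; rewrite [RHS]big_mkcond; apply: eq_bigr => i _.
case: ifPn => [iJ|iJ]; first by rewrite EA.
by rewrite ET// preimage_setT probability_setT.
Qed.

Section product_probability_independence.
Context {R : realType} {d1 d2 d : measure_display}.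
Context {O1 : measurableType d1} {O2 : measurableType d2}
  {T : measurableType d}.
Context {d' : measure_display} {T' : measurableType d'}.
Variables (P1 : probability O1 R) (P2 : probability O2 R).

(** The pairs (Z1 i, Z2 i) are shown to be independent, and [f] is then applied to each of them. By
    [independent_generation] it suffices to test rectangles, where the event splits into one event
    for each factor of the product space. *)
Lemma product_measure_preimages k (Z1 : 'I_k -> O1 -> T) (Z2 : 'I_k -> O2 -> T) 
    (f : T * T -> T') :
  (forall i, measurable_fun setT (Z1 i)) ->
  (forall i, measurable_fun setT (Z2 i)) ->
  measurable_fun setT f ->
  mutually_independent P1 (fun i => preimage_set_system setT (Z1 i) measurable)
    ->
  mutually_independent P2 (fun i => preimage_set_system setT (Z2 i) measurable)
    ->
  mutually_independent (P1 \x P2)%E (fun i => preimage_set_system setT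
    (fun w : O1 * O2 => f (Z1 i w.1, Z2 i w.2)) measurable).
Proof.
move=> mZ1 mZ2 mf ind1 ind2.
have mX i : measurable_fun setT (fun w : O1 * O2 => (Z1 i w.1, Z2 i w.2)).
  by apply: measurable_fun_pair; apply: measurableT_comp => //.
apply/mutually_independent_preimageP => [i|E mE].
  exact: (measurableT_comp mf (mX i)).
pose G := [set A `*` B | A in @measurable _ T & B in @measurable _ T].
have mG : measurable = <<s G >> by rewrite measurable_prod_measurableType.
apply: (independent_generation (P := (P1 \x P2)%E) mX mG _ _ _
    (fun i => measurable_preimage mf (mE i))).
- move=> _ _ [A mA [B mB <-]] [A' mA' [B' mB' <-]].
  exists (A `&` A'); first exact: measurableI.
  by exists (B `&` B'); [exact: measurableI|rewrite setXI].
- by exists setT => //; exists setT => //; rewrite setXTT.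
move=> {}E {}mE.
pose A i := sval (cid2 (mE i)).
have mA i : measurable (A i) by rewrite /A; case: cid2.
have AE i : [set A i `*` B | B in measurable] (E i) by rewrite /A; case: cid2.
pose B i := sval (cid2 (AE i)).
have mB i : measurable (B i) by rewrite /B; case: cid2.
have BE i : A i `*` B i = E i by rewrite /B; case: cid2.
rewrite (_ : [set _ | _] =
    [set w | forall i, A i (Z1 i w)] `*` [set w | forall i, B i (Z2 i w)]).
  have mA' : measurable [set w | forall i, A i (Z1 i w)].
    by apply: measurable_forall => i; exact: measurable_preimage.
  have mB' : measurable [set w | forall i, B i (Z2 i w)].
    by apply: measurable_forall => i; exact: measurable_preimage.
  apply: (etrans (product_measure1E P1 P2 mA' mB')).
  have e1 := (mutually_independent_preimageP P1 mZ1).1 ind1 A mA.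
  have e2 := (mutually_independent_preimageP P2 mZ2).1 ind2 B mB.
  apply: (etrans (congr2 (fun x y => x * y)%E e1 e2)).
  rewrite -big_split/=; apply: eq_bigr => i _.
  by rewrite -BE -product_measure1E//; exact: measurable_preimage.
apply/seteqP; split => w /=.
  by move=> h; split=> i; have := h i; rewrite -BE => -[].
by move=> [h1 h2] i; rewrite -BE.
Qed.

End product_probability_independence.

(** Null sets of the intensity bring in the parameter 0, for which [poisson_prob] is the point mass
    at 0; the formula persists there because 0 to the power 0 is 1. *)
Lemma poisson_prob1E (R : realType) (r : R) (k : nat) : 0 <= r ->
  poisson_prob r 0 [set k] = (r ^+ k / k`!%:R * expR (- r))%:E.
Proof.
rewrite le_eqVlt => /predU1P[<-|r0].
  rewrite /poisson_prob ltxx oppr0 expR0 mulr1 diracE.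
  case: k => [|k]; first by rewrite mem_set//= fact0 divr1.
  by rewrite memNset// exprS mul0r mul0r.
rewrite /poisson_prob r0 esum_set1 ?lee_fin ?poisson_pmf_ge0//.
by rewrite /poisson_pmf r0.
Qed.

Lemma poisson_convolution (R : realType) (r s : R) (k : nat) :
  0 <= r -> 0 <= s ->
  (\sum_(i < k.+1) poisson_prob r 0 [set (i : nat)] *
     poisson_prob s 0 [set (k - i)%N] = poisson_prob (r + s) 0 [set k])%E.
Proof.
move=> r0 s0; rewrite poisson_prob1E ?addr_ge0//.
under eq_bigr do rewrite !poisson_prob1E// -EFinM.
rewrite sumEFin; congr EFin; rewrite addrC exprDn !mulr_suml.
apply: eq_bigr => i _; have ik : (i <= k)%N by rewrite -ltnS.
rewrite opprD expRD -(bin_fact ik) !natrM.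
have f0 (j : nat) : j`!%:R != 0 :> R by rewrite pnatr_eq0 -lt0n fact_gt0.
have b0 : 'C(k, i)%:R != 0 :> R by rewrite pnatr_eq0 -lt0n bin_gt0.
rewrite -[_ *+ 'C(_, _)]mulr_natl; have := f0 i; have := f0 (k - i)%N; move: b0.
move: ('C(k, i)%:R : R) (i`!%:R : R) ((k - i)`!%:R : R) => b x y b0 y0 x0.
by field; rewrite b0 x0 y0.
Qed.

Lemma product_measure_eq_on d1 d2 (O1 : measurableType d1)
    (O2 : measurableType d2) (R : realType) (P1 : probability O1 R)
    (P2 : probability O2 R) (S1 : set O1) (S2 : set O2) (A B : set (O1 * O2)) :
  measurable S1 -> measurable S2 -> (P1 S1 = 1 -> P2 S2 = 1 ->
  measurable A -> measurable B -> A `&` (S1 `*` S2) = B `&` (S1 `*` S2) ->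
  (P1 \x P2) A = (P1 \x P2) B)%E.
Proof.
move=> mS1 mS2 PS1 PS2 mA mB; apply: measure_eq_on => //.
  exact: measurableX.
have mS : measurable (S1 `*` S2) by exact: measurableX.
have e1 : ((P1 \x P2) (S1 `*` S2) = 1)%E.
  apply: (etrans (product_measure1E P1 P2 mS1 mS2)).
  by apply: (etrans (congr2 (fun x y => x * y)%E PS1 PS2)); rewrite mule1.
apply: (etrans (probability_setC (P1 \x P2)%E mS)).
by apply: (etrans (congr1 (fun x => 1 - x)%E e1)); rewrite subee.
Qed.

Section superposition.
Context {R : realType} {d1 d2 dT : measure_display}.
Context {O1 : measurableType d1} {O2 : measurableType d2}
  {T : measurableType dT}.
Variables (N1 : R.-ker O1 ~> T) (N2 : R.-ker O2 ~> T).

Definition superposition (w : O1 * O2) : {measure set T -> \bar R} :=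
  measure_add (N1 w.1) (N2 w.2).

Lemma superpositionE w A : superposition w A = (N1 w.1 A + N2 w.2 A)%E.
Proof. exact: measure_addE. Qed.

Lemma measurable_superposition (A : set T) : measurable A ->
  measurable_fun setT (superposition ^~ A).
Proof.
move=> mA; under eq_fun do rewrite superpositionE.
by apply: emeasurable_funD;
  exact: (measurableT_comp (measurable_kernel _ _ mA)).
Qed.

HB.instance Definition _ :=
  isKernel.Build _ _ _ _ R superposition measurable_superposition.

Variables (P1 : probability O1 R) (P2 : probability O2 R).
Variables (n1 n2 : {measure set T -> \bar R}).
Hypotheses (hN1 : poisson_random_measure P1 n1 N1)
  (hN2 : poisson_random_measure P2 n2 N2).

Local Open Scope ereal_scope.

Let superposition_fin (A : set T) : measurable A -> n1 A + n2 A < +oo ->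
  forall k : nat, (P1 \x P2) [set w | superposition w A = k%:R%:E] =
    poisson_prob (fine (n1 A + n2 A)) k [set k].
Proof.
move=> mA nAoo k.
have n1oo : n1 A < +oo by apply: le_lt_trans nAoo; rewrite leeDl.
have n2oo : n2 A < +oo by apply: le_lt_trans nAoo; rewrite leeDr.
have f1 : n1 A \is a fin_num by rewrite ge0_fin_numE.
have f2 : n2 A \is a fin_num by rewrite ge0_fin_numE.
(* Non-integer values could also add up to [k], so both counts are first restricted to integers, an
   event of full probability. There the event {sum = k} is the disjoint union of the sets [C i], and
   the Poisson convolution formula applies. *)
pose nats := range (fun k : nat => k%:R%:E : \bar R).
have mnats : measurable nats.
  apply: countable_measurable => [t|]; first exact: emeasurable_set1.
  exact: (card_le_trans (card_image_le _ _)).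
have Pnats d (O : measurableType d) (P : probability O R) (N : R.-ker O ~> T)
    (n : {measure set T -> \bar R}) : poisson_random_measure P n N ->
    n A \is a fin_num -> P ((N ^~ A) @^-1` nats) = 1.
  move=> hN fn; rewrite (prm_law hN)// -(fineK fn) /=.
  rewrite (_ : [set _ | _] = setT) ?probability_setT//.
  by apply/seteqP; split => // j _; exists j.
have mN1 B : measurable B -> measurable ((N1 ^~ A) @^-1` B).
  by move=> mB; exact: measurable_preimage (measurable_kernel _ _ mA) mB.
have mN2 B : measurable B -> measurable ((N2 ^~ A) @^-1` B).
  by move=> mB; exact: measurable_preimage (measurable_kernel _ _ mA) mB.
pose C (i : 'I_k.+1) := [set w | N1 w A = i%:R%:E] `*`
  [set w | N2 w A = (k - i)%:R%:E].
have mC i : measurable (C i).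
  apply: measurableX; first exact: mN1 (emeasurable_set1 _).
  exact: mN2 (emeasurable_set1 _).
rewrite (@product_measure_eq_on _ _ _ _ _ P1 P2 ((N1 ^~ A) @^-1` nats)
  ((N2 ^~ A) @^-1` nats) _
    (\big[setU/set0]_(i < k.+1) C i)) //.
- apply: (etrans (measure_bigsetU_ord (P1 \x P2) xpredT mC _)).
    move=> i j _ _ [w [[/= wi _] [wj _]]]; apply/val_inj/eqP => /=.
    by move: wi; rewrite wj => -[] /eqP; rewrite eqr_nat eq_sym.
  rewrite fineD// poisson_prob_set1 -poisson_convolution ?fine_ge0//.
  apply: eq_bigr => i _.
  apply: (etrans (product_measure1E P1 P2 (mN1 _ (emeasurable_set1 _))
    (mN2 _ (emeasurable_set1 _)))).
  have [h1 _ _] := hN1; have [h2 _ _] := hN2.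
  exact: (congr2 (fun x y => x * y) (h1 A mA n1oo i) (h2 A mA n2oo (k - i)%N)).
- exact: mN1.
- exact: mN2.
- exact: Pnats hN1 f1.
- exact: Pnats hN2 f2.
- exact: measurable_preimage (measurable_superposition mA) (emeasurable_set1 _).
- exact: bigsetU_measurable.
apply/seteqP; split => -[w1 w2] [].
  move=> /(etrans (esym (superpositionE (w1, w2) A))) /= N12
    [[i _ Ni] [j _ Nj]].
  split; last by split; [exists i|exists j].
  move: N12; rewrite -Ni -Nj -EFinD => -[]; rewrite -natrD => /eqP;
    rewrite eqr_nat => /eqP ijk.
  have ik : (i < k.+1)%N by rewrite ltnS -ijk leq_addr.
  by rewrite (bigD1 (Ordinal ik))//; left; split => /=;
    rewrite -?Ni// -?Nj -ijk addKn.
move=> Cw [n1w n2w]; split => //; apply: (etrans (superpositionE (w1, w2) A))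
  => /=.
move: Cw; elim/big_ind: _ => // [F F' FF FF' [/FF|/FF']|i _ [/= -> ->]]//.
by rewrite -EFinD -natrD subnKC// -ltnS.
Qed.

Lemma prm_superposition :
  poisson_random_measure (P1 \x P2) (measure_add n1 n2) superposition.
Proof.
have [_ hoo1 hind1] := hN1; have [_ hoo2 hind2] := hN2.
split.
- move=> A mA nAoo k; have := superposition_fin mA.
  by rewrite -measure_addE => /(_ nAoo k).
- move=> A mA /(etrans (esym (measure_addE n1 n2 A))) nAoo.
  have mN1 : measurable_fun setT (N1 ^~ A) by exact: measurable_kernel.
  have mN2 : measurable_fun setT (N2 ^~ A) by exact: measurable_kernel.
  rewrite -(probability_setT (P1 \x P2)).
  have mS : measurable [set w | superposition w A = +oo].
    exact: measurable_preimage (measurable_superposition mA)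
      (emeasurable_set1 _).
  (* An infinite total forces one of the two intensities to be infinite; the corresponding count is
     almost surely infinite and makes the sum infinite. *)
  have [n1oo|n1oo] := eqVneq (n1 A) +oo.
    apply: (@product_measure_eq_on _ _ _ _ _ P1 P2 [set w | N1 w A = +oo] setT)
      => //.
    + exact: measurable_preimage mN1 (emeasurable_set1 _).
    + exact: hoo1.
    + exact: probability_setT.
    rewrite setTI; apply/setIidPr => w /= [Nw _];
      apply: (etrans (superpositionE w A)); rewrite Nw addye//.
    by rewrite gt_eqF// (lt_le_trans _ (measure_ge0 _ _)).
  have n2oo : n2 A = +oo.
    apply/eqP; rewrite -leye_eq leNgt; apply/negP => n2oo.
    have : n1 A + n2 A < +oo by rewrite lte_add_pinfty// lt_neqAle n1oo leey.
    by rewrite nAoo.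
  apply: (@product_measure_eq_on _ _ _ _ _ P1 P2 setT [set w | N2 w A = +oo])
    => //.
  + exact: measurable_preimage mN2 (emeasurable_set1 _).
  + exact: probability_setT.
  + exact: hoo2.
  rewrite setTI; apply/setIidPr => w /= [_ Nw];
    apply: (etrans (superpositionE w A)); rewrite Nw addey//.
  by rewrite gt_eqF// (lt_le_trans _ (measure_ge0 _ _)).
move=> k A mA tA.
rewrite (_ : (fun i => _) = (fun i => preimage_set_system setT
    (fun w : O1 * O2 => (fun p : \bar R * \bar R => p.1 + p.2)
      (N1 w.1 (A i), N2 w.2 (A i))) measurable)).
  have mN1 i : measurable_fun setT (N1 ^~ (A i)) by exact: measurable_kernel.
  have mN2 i : measurable_fun setT (N2 ^~ (A i)) by exact: measurable_kernel.
  have mD : measurable_fun setT (fun p : \bar R * \bar R => p.1 + p.2).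
    by apply: emeasurable_funD; [exact: measurable_fst|exact: measurable_snd].
  exact: (product_measure_preimages mN1 mN2 mD (hind1 k A mA tA)
    (hind2 k A mA tA)).
by apply/funext => i; congr preimage_set_system; apply/funext => w;
  exact: superpositionE.
Qed.

End superposition.

(** * Almost sure integrability, and integrals against a superposition *)

Section truncated_integrability.
Context {R : realType} {dT : measure_display} {T : measurableType dT}.
Variables (n : {measure set T -> \bar R}) (h : T -> R).
Hypothesis mh : measurable_fun setT h.
Local Open Scope ereal_scope.

Let mabs : measurable_fun setT (fun z => `|h z|%:E).
Proof. by apply/measurable_EFinP; exact: measurableT_comp. Qed.

Hypothesis hfin : \int[n]_z (Num.min `|h z| (h z ^+ 2))%:E < +oo.

Lemma integrable_exceedance (eps : R) : (0 < eps)%R ->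
  n.-integrable [set z | (eps < `|h z|)%R] (EFin \o h).
Proof.
move=> eps0; have mD := measurable_exceedance eps mh.
set D := [set z | _] in mD *.
apply/integrableP; split; first by apply: measurable_funTS;
  exact/measurable_EFinP.
(* On {|h| > eps}, |h| <= max (1, 1 / eps) min (|h|, h^2). *)
pose C := (Num.max 1 eps^-1)%R.
have C0 : (0 <= C)%R by rewrite le_max ler01.
have mmin : measurable_fun setT (fun z => (Num.min `|h z| (h z ^+ 2))%:E).
  apply/measurable_EFinP; apply: measurable_minr; last exact: measurable_funX.
  exact: measurableT_comp.
have min0 z : 0 <= (Num.min `|h z| (h z ^+ 2))%:E.
  by rewrite lee_fin le_min normr_ge0 sqr_ge0.
apply: (@le_lt_trans _ _ (\int[n]_(z in D)
  (C%:E * (Num.min `|h z| (h z ^+ 2))%:E))).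
  apply: ge0_le_integral => //.
  - exact: measurable_funTS.
  - by apply: measurable_funTS; exact: measurable_funeM.
  move=> z /= epsh; rewrite lee_fin.
  have [h1|h1] := lerP 1%R `|h z|%R.
    rewrite min_l; last by rewrite -real_normK ?num_real// expr2 ler_peMl.
    by rewrite ler_peMl// le_max lexx.
  rewrite min_r; last by rewrite -real_normK ?num_real// expr2 ler_piMl// ltW.
  apply: (@le_trans _ _ (eps^-1 * h z ^+ 2)%R); last first.
    by rewrite ler_wpM2r ?sqr_ge0// le_max lexx orbT.
  rewrite ler_pdivlMl// -real_normK ?num_real// expr2.
  by rewrite ler_wpM2r// ltW.
rewrite ge0_integralZl//; last exact: measurable_funTS.
apply: lte_mul_pinfty => //; apply: le_lt_trans hfin.
by apply: ge0_subset_integral => //; exact: measurable_funTS.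
Qed.

(** Markov's inequality: eps times this mass is at most the integral of |h| over the same set. *)
Lemma exceedance_lty (eps : R) : (0 < eps)%R ->
  n [set z | (eps < `|h z|)%R] < +oo.
Proof.
move=> eps0; have mD := measurable_exceedance eps mh.
set D := [set z | _] in mD *.
have /integrableP[_] := integrable_exceedance eps0; rewrite -/D => int.
have : eps%:E * n D < +oo.
  apply: le_lt_trans int; rewrite -integral_cst//.
  apply: ge0_le_integral => //=.
  - by move=> z _; rewrite lee_fin ltW.
  - exact: measurable_funTS.
  - by move=> z /= ?; rewrite lee_fin ltW.
rewrite !lt_neqAle !leey !andbT; apply: contra => /eqP ->.
by rewrite gt0_muley.
Qed.

End truncated_integrability.

Section poisson_integrability.
Context {R : realType} {dO dT : measure_display}.
Context {O : measurableType dO} {T : measurableType dT}.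
Variables (P : probability O R) (n : {measure set T -> \bar R}).
Variable N : R.-ker O ~> T.
Hypothesis hN : poisson_random_measure P n N.
Variable h : T -> R.
Hypothesis mh : measurable_fun setT h.
Hypothesis hfin : (\int[n]_z (Num.min `|h z| (h z ^+ 2))%:E < +oo)%E.
Local Open Scope ereal_scope.

Lemma prm_lty (A : set T) : measurable A -> n A < +oo ->
  P [set w | N w A < +oo] = 1.
Proof.
move=> mA nA; have mE : measurable [set x : \bar R | x < +oo].
  rewrite (_ : mkset _ = ~` [set +oo]); first exact: measurableC.
  by apply/seteqP; split => x /=; rewrite ltey => /eqP.
rewrite [LHS](prm_law hN mA mE) -(fineK (_ : n A \is a fin_num))
  ?ge0_fin_numE//=.
rewrite (_ : [set k | _] = setT) ?probability_setT//.
by apply/seteqP; split => // k _ /=; rewrite ltry.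
Qed.

Lemma prm_ae_null_exceedance :
  P [set w | exists j : nat, N w [set z | (j.+1%:R < `|h z|)%R] = 0] = 1.
Proof.
pose A (j : nat) := [set z | (j.+1%:R < `|h z|)%R].
have mA j : measurable (A j) by exact: measurable_exceedance.
have nA j : n (A j) < +oo by apply: exceedance_lty.
have m0 j : measurable [set w | N w (A j) = 0].
  exact: measurable_preimage (measurable_kernel N _ (mA j))
    (emeasurable_set1 _).
have -> : [set w | exists j : nat, N w (A j) = 0] =
  \bigcup_j [set w | N w (A j) = 0].
  by apply/seteqP; split => [w [j ?]|w [j _ ?]]; exists j.
have mU : measurable (\bigcup_j [set w | N w (A j) = 0])
  by exact: bigcup_measurable.
apply/eqP; rewrite eq_le probability_le1//=.
(* P (N (A j) = 0) = exp (- n (A j)) >= 1 - n (A j), and n (A j) tends to 0. *)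
have bound j : 1 <= P (\bigcup_j [set w | N w (A j) = 0]) + n (A j).
  have fn : n (A j) \is a fin_num by rewrite ge0_fin_numE.
  apply: (@le_trans _ _ (P [set w | N w (A j) = 0] + n (A j))); last first.
    by apply: leeD2r; rewrite le_measure ?inE// => w Nw; exists j.
  have [hP _ _] := hN; rewrite (hP _ (mA j) (nA j) 0%N).
  rewrite poisson_prob1E ?fine_ge0// expr0 fact0 divr1 mul1r.
  rewrite -{2}(fineK fn) -EFinD lee_fin.
  by have := expR_ge1Dx (- fine (n (A j))); rewrite lerBlDr.
have cvgA : n (A j) @[j --> \oo] --> n (\bigcap_j A j).
  apply: nonincreasing_cvg_mu => //; first exact: bigcap_measurable.
  move=> i j ij; apply/subsetPset => z; apply: le_lt_trans.
  by rewrite ler_nat ltnS.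
have A0 : \bigcap_j A j = set0.
  apply/seteqP; split => // z Az.
  have := Az (Num.truncn `|h z|) I; rewrite /A /= ltNge => /negP; apply.
  by rewrite ltW// truncnS_gt.
rewrite A0 measure0 in cvgA.
have : P (\bigcup_j [set w | N w (A j) = 0]) + n (A j) @[j --> \oo] -->
    P (\bigcup_j [set w | N w (A j) = 0]) + 0.
  by apply: cvgeD => //; [rewrite fin_num_adde_defl|exact: cvg_cst].
rewrite adde0; apply: cvge_ge; by near do exact: bound.
Unshelve. all: by end_near. Qed.

Lemma integrable_bounded_exceedance (m : {measure set T -> \bar R})
  (eps K : R) :
  (0 <= K)%R -> m [set z | (eps < `|h z|)%R] < +oo ->
  m [set z | (K < `|h z|)%R] = 0 ->
  m.-integrable [set z | (eps < `|h z|)%R] (EFin \o h).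
Proof.
move=> K0 mD mK.
have mmD := measurable_exceedance eps mh;
  have mmK := measurable_exceedance K mh.
set D := [set z | _] in mD mmD *; set E := [set z | _] in mK mmK *.
have mabs : measurable_fun setT (fun z => `|h z|%:E).
  by apply/measurable_EFinP; exact: measurableT_comp.
apply/integrableP; split; first by apply: measurable_funTS;
  exact/measurable_EFinP.
rewrite (ge0_negligible_integral mmK)//; last exact: measurable_funTS.
apply: (@le_lt_trans _ _ (\int[m]_(z in D `\` E) (cst K%:E z))).
  apply: ge0_le_integral => //.
  - exact: measurableD.
  - exact: measurable_funTS.
  - by move=> z [_ /negP]; rewrite -leNgt lee_fin.
rewrite integral_cst; last exact: measurableD.
apply: lte_mul_pinfty => //.
apply: le_lt_trans mD; rewrite le_measure ?inE//; exact: measurableD.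
Qed.

(** Almost surely N w gives finite mass to {|h| > eps} and none to {|h| > j+1} for some j; there [h]
    is essentially bounded on a set of finite mass. *)
Lemma prm_ae_integrable (eps : R) : (0 < eps)%R ->
  exists S : set O, [/\ measurable S, P S = 1 &
    forall w, S w -> (N w).-integrable [set z | (eps < `|h z|)%R] (EFin \o h)].
Proof.
move=> eps0; have mD := measurable_exceedance eps mh.
pose A (j : nat) := [set z | (j.+1%:R < `|h z|)%R].
have mA j : measurable (A j) by exact: measurable_exceedance.
have mS1 : measurable [set w | N w [set z | (eps < `|h z|)%R] < +oo].
  rewrite (_ : mkset _ = (N ^~ [set z | (eps < `|h z|)%R]) @^-1` ~` [set +oo]).
    exact: measurable_preimage (measurable_kernel N _ mD)
      (measurableC (emeasurable_set1 _)).
  by apply/seteqP; split => w /=; rewrite ltey => /eqP.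
have mS2 : measurable [set w | exists j, N w (A j) = 0].
  rewrite (_ : mkset _ = \bigcup_j [set w | N w (A j) = 0]); last first.
    by apply/seteqP; split => [w [j ?]|w [j _ ?]]; exists j.
  apply: bigcup_measurable => j _.
  exact: measurable_preimage (measurable_kernel N _ (mA j))
    (emeasurable_set1 _).
exists ([set w | N w [set z | (eps < `|h z|)%R] < +oo] `&`
  [set w | exists j, N w (A j) = 0]).
split; first exact: measurableI.
- rewrite -(prm_lty mD (exceedance_lty mh hfin eps0)).
  apply: (measure_eq_on mS2) => //; first exact: measurableI.
    apply: (etrans (probability_setC P mS2)).
    by apply: (etrans (congr1 (fun x => 1 - x) prm_ae_null_exceedance));
      rewrite subee.
  by rewrite -setIA setIid.
by move=> w [wD [j wj]]; exact: integrable_bounded_exceedance wj.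
Qed.

End poisson_integrability.

Section superposition_integral.
Context {R : realType} {d1 d2 dT : measure_display}.
Context {O1 : measurableType d1} {O2 : measurableType d2}
  {T : measurableType dT}.
Variables (N1 : R.-ker O1 ~> T) (N2 : R.-ker O2 ~> T).
Variables (P1 : probability O1 R) (P2 : probability O2 R).
Variables (n1 n2 : {measure set T -> \bar R}).
Hypotheses (hN1 : poisson_random_measure P1 n1 N1)
  (hN2 : poisson_random_measure P2 n2 N2).
Variables (h : T -> R) (Y1 : O1 -> R) (Y2 : O2 -> R).
Hypotheses (hY1 : is_compensated_integral P1 n1 N1 h Y1)
  (hY2 : is_compensated_integral P2 n2 N2 h Y2).

Lemma Rintegral_measure_add (m1 m2 : {measure set T -> \bar R}) (D : set T) :
  measurable D -> m1.-integrable D (EFin \o h) ->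
    m2.-integrable D (EFin \o h) ->
  (\int[measure_add m1 m2]_(z in D) h z =
   \int[m1]_(z in D) h z + \int[m2]_(z in D) h z)%R.
Proof.
move=> mD i1 i2; rewrite /Rintegral integral_measure_add// fineD//;
  exact: integrable_fin_num.
Qed.

(** On the almost sure event where [h] is integrable for both random measures, the truncation of the
    sum is the sum of the truncations. An error above [eta] then forces one of the two errors above
    [eta / 2]. *)
Lemma compensated_integral_superposition :
  is_compensated_integral (P1 \x P2)%E (measure_add n1 n2)
    (superposition N1 N2) h
    (fun w : O1 * O2 => Y1 w.1 + Y2 w.2).
Proof.
have [mh fin1 mY1 cvg1] := hY1; have [_ fin2 mY2 cvg2] := hY2.
have mmin : measurable_fun setT (fun z => (Num.min `|h z| (h z ^+ 2))%:E).
  apply/measurable_EFinP; apply: measurable_minr; last exact: measurable_funX.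
  exact: measurableT_comp.
have mY : measurable_fun setT (fun w : O1 * O2 => Y1 w.1 + Y2 w.2).
  by apply: measurable_funD; apply: measurableT_comp.
split => //.
  rewrite ge0_integral_measure_add//; first exact: lte_add_pinfty.
  by move=> z _; rewrite lee_fin le_min normr_ge0 sqr_ge0.
move=> eta eta0; have e20 : 0 < eta / 2 by rewrite divr_gt0.
pose b1 eps := [set w | eta / 2 < `|Y1 w - compensated_truncation n1 N1 h eps
  w|].
pose b2 eps := [set w | eta / 2 < `|Y2 w - compensated_truncation n2 N2 h eps
  w|].
pose b eps := [set w : O1 * O2 | eta < `|Y1 w.1 + Y2 w.2 -
  compensated_truncation (measure_add n1 n2) (superposition N1 N2) h eps w|].
have mb d (O : measurableType d) (n : {measure set T -> \bar R})
    (N : R.-ker O ~> T) (Y : O -> R) (e eps : R) :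
    measurable_fun setT Y ->
    measurable [set w | e < `|Y w - compensated_truncation n N h eps w|].
  move=> mmY; rewrite -[X in measurable X]setTI;
    apply: measurable_fun_ltr => //.
  apply: measurableT_comp => //; apply: measurable_funB => //.
  exact: measurable_compensated_truncation.
have bound eps : 0 < eps -> ((P1 \x P2) (b eps) <= P1 (b1 eps) + P2 (b2 eps))%E.
  move=> eps0.
  have [S1 [mS1 PS1 int1]] := prm_ae_integrable hN1 mh fin1 eps0.
  have [S2 [mS2 PS2 int2]] := prm_ae_integrable hN2 mh fin2 eps0.
  have i1 := integrable_exceedance mh fin1 eps0.
  have i2 := integrable_exceedance mh fin2 eps0.
  have mD := measurable_exceedance eps mh.
  have mbb : measurable (b eps) by exact: (mb _ _ _ (superposition N1 N2)).
  have mS : measurable (S1 `*` S2) by exact: measurableX.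
  have mB1 : measurable (b1 eps `*` [set: O2]) by apply: measurableX => //;
    exact: mb.
  have mB2 : measurable ([set: O1] `*` b2 eps) by apply: measurableX => //;
    exact: mb.
  (* Discards the outcomes where [fine] of an infinite or undefined integral could break
     additivity. *)
  have -> : (P1 \x P2)%E (b eps) = (P1 \x P2)%E (b eps `&` (S1 `*` S2)).
    apply: (product_measure_eq_on (P1 := P1) (P2 := P2) mS1 mS2) => //.
      exact: measurableI.
    by rewrite -setIA setIid.
  apply: (@le_trans _ _ ((P1 \x P2)%E
    ((b1 eps `*` [set: O2]) `|` ([set: O1] `*` b2 eps)))).
    rewrite le_measure ?inE//; [exact: measurableI|exact: measurableU|].
    move=> -[w1 w2] /= [bw [S1w S2w]].
    have [h1|h1] := ltP (eta / 2) `|Y1 w1 - compensated_truncation n1 N1 h eps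
      w1|.
      by left.
    right; split => //; rewrite /b2 /= ltNge; apply/negP => h2.
    move: bw; rewrite /b /=; apply/negP; rewrite -leNgt.
    rewrite (_ : _ - _ = (Y1 w1 - compensated_truncation n1 N1 h eps w1) +
       (Y2 w2 - compensated_truncation n2 N2 h eps w2)).
      by apply: (le_trans (ler_normD _ _)); rewrite [leRHS]splitr lerD.
    rewrite /compensated_truncation.
    rewrite (Rintegral_measure_add mD (int1 _ S1w) (int2 _ S2w)).
    rewrite (Rintegral_measure_add mD i1 i2).
    ring.
  apply: (le_trans (measureU2 (P1 \x P2)%E mB1 mB2)).
  have e1 : ((P1 \x P2) (b1 eps `*` setT) = P1 (b1 eps))%E.
    have mb1 : measurable (b1 eps) by exact: mb.
    apply: (etrans (product_measure1E P1 P2 mb1 measurableT)).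
    by apply: (etrans (congr1 (fun x => P1 (b1 eps) * x)%E
      (probability_setT P2))); exact: mule1.
  have e2 : ((P1 \x P2) (setT `*` b2 eps) = P2 (b2 eps))%E.
    have mb2 : measurable (b2 eps) by exact: mb.
    apply: (etrans (product_measure1E P1 P2 measurableT mb2)).
    by apply: (etrans (congr1 (fun x => x * P2 (b2 eps))%E
      (probability_setT P1))); exact: mul1e.
  apply: leeD; rewrite le_eqVlt; apply/orP; left; apply/eqP; first exact: e1.
  exact: e2.
have cvgb : (P1 (b1 eps) + P2 (b2 eps))%E @[eps --> 0^'+] --> (0 + 0)%E.
  by apply: cvgeD => //; [exact: cvg1|exact: cvg2].
rewrite adde0 in cvgb.
apply: (squeeze_cvge _ (cvg_cst 0%E) cvgb).
near=> eps; rewrite measure_ge0/=; apply: bound; near: eps;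
  exact: nbhs_right_gt.
Unshelve. all: by end_near. Qed.

End superposition_integral.

(** * Sums of independent copies *)

Section independent_sums.
Context {R : realType} {dO dT : measure_display}.
Context {O : measurableType dO} {T : measurableType dT}.
Variables (P : probability O R) (n : {measure set T -> \bar R}).
Variable N : R.-ker O ~> T.
Hypothesis hN : poisson_random_measure P n N.
Variables (I : Type) (D : set I) (h : I -> T -> R) (J : I -> O -> R).
Hypothesis hJ : forall t, D t -> is_compensated_integral P n N (h t) (J t).

Lemma measurable_tuple_field d (S : measurableType d) k (X : 'I_k -> S -> R) :
  (forall i, measurable_fun setT (X i)) ->
  measurable_fun setT (fun w => [tuple X i w | i < k]).
Proof.
move=> mX; apply/measurable_fun_tnthP => i; rewrite (_ : _ \o _ = X i)//.
by apply/funext => w /=; rewrite tnth_mktuple.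
Qed.

(** The induction starts from [N] itself, hence the index [m.+1]. The intensity [nu], a nested
    [measure_add], is described by its values on measurable sets. Independence and equality in law
    of the copies are recorded together as a factorisation over boxes, the form in which given
    copies are compared. *)
Lemma iid_superposition (m : nat) :
  exists d (S : measurableType d) (Q : probability S R) (M : R.-ker S ~> T)
    (nu : {measure set T -> \bar R}) (Z : 'I_m.+1 -> I -> S -> R),
  [/\ poisson_random_measure Q nu M,
      forall A, measurable A -> nu A = (m.+1%:R%:E * n A)%E,
      forall i t, D t -> measurable_fun setT (Z i t),
      forall t, D t -> is_compensated_integral Q nu M (h t)
        (fun w => \sum_i Z i t w)
    & forall k (t : 'I_k -> I) (E : 'I_m.+1 -> set (k.-tuple R)),
        (forall i, D (t i)) -> (forall i, measurable (E i)) ->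
        Q [set w | forall i, E i [tuple Z i (t j) w | j < k]] =
        (\prod_i P [set w | E i [tuple J (t j) w | j < k]])%E].
Proof.
elim: m => [|m [d [S [Q [M [nu [Z [hM nuE mZ hZ ZE]]]]]]]].
  exists dO, O, P, N, n, (fun=> J); split => //.
  - by move=> A mA; rewrite mul1e.
  - by move=> i t /hJ[].
  - by move=> t /hJ; under eq_fun do rewrite big_ord1.
  move=> k t E Dt mE; rewrite big_ord1; congr (P _).
  by apply/seteqP; split => [w /=|w /= Ew i]; [exact|rewrite ord1].
(* The new copy has index [ord0] and reads the first factor; the earlier copies are shifted by
   [lift ord0] and read the second. *)
pose Z' (i : 'I_m.+2) t (w : O * S) :=
  if unlift ord0 i is Some j then Z j t w.2 else J t w.1.
have Z0 t w : Z' ord0 t w = J t w.1 by rewrite /Z' unlift_none.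
have ZS j t w : Z' (lift ord0 j) t w = Z j t w.2 by rewrite /Z' liftK.
exists (dO, d).-prod%mdisp, (O * S)%type, (P \x Q)%E, (superposition N M),
  (measure_add n nu), Z'.
split.
- exact: prm_superposition.
- move=> A mA; apply: (etrans (measure_addE n nu A)); rewrite nuE//.
  by rewrite -[X in (X + _)%E]mul1e -ge0_muleDl ?lee_fin// -EFinD -natrD.
- move=> i t Dt; case: (unliftP ord0 i) => [j ->|->].
    rewrite (_ : Z' _ t = Z j t \o snd);
      first exact: measurableT_comp (mZ j t Dt) _.
    by apply/funext => w; exact: ZS.
  have [_ _ mJ _] := hJ Dt.
  rewrite (_ : Z' _ t = J t \o fst); first exact: measurableT_comp mJ _.
  by apply/funext => w; exact: Z0.
- move=> t Dt; rewrite (_ : (fun w => _) = fun w => J t w.1 + \sum_i Z i t w.2).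
    exact: (compensated_integral_superposition hN hM (hJ Dt) (hZ t Dt)).
  apply/funext => w; rewrite big_ord_recl Z0; congr (_ + _).
  by apply: eq_bigr => i _; rewrite ZS.
move=> k t E Dt mE; rewrite big_ord_recl.
rewrite -(ZE k t (fun i => E (lift ord0 i)))//.
have mA : measurable [set w | E ord0 [tuple J (t j) w | j < k]].
  apply: (measurable_preimage _ (mE ord0)); apply: measurable_tuple_field => i.
  by have [] := hJ (Dt i).
have mB : measurable [set w | forall i, E (lift ord0 i)
  [tuple Z i (t j) w | j < k]].
  apply: measurable_forall => i; apply: (measurable_preimage _ (mE _)).
  by apply: measurable_tuple_field => j; exact: mZ.
rewrite -[RHS](product_measure1E P Q mA mB); congr ((P \x Q)%E _).
apply/seteqP; split => w /= Ew.
  split; first by have := Ew ord0; under eq_mktuple do rewrite Z0.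
  by move=> i; have := Ew (lift ord0 i); under eq_mktuple do rewrite ZS.
move=> i; case: (unliftP ord0 i) => [j ->|->].
  by under eq_mktuple do rewrite ZS; exact: Ew.2.
by under eq_mktuple do rewrite Z0; exact: Ew.1.
Qed.

End independent_sums.

Section independent_copies_law.
Context {R : realType} {I : Type} (D : set I).
Context {d1 d2 : measure_display} {O1 : measurableType d1}
  {O2 : measurableType d2}.
Variables (P1 : probability O1 R) (X : I -> O1 -> R).
Variables (P2 : probability O2 R) (m : nat) (Xs : 'I_m -> I -> O2 -> R).

Lemma independent_copies_boxes k (t : 'I_k -> I)
  (E : 'I_m -> set (k.-tuple R)) :
  independent_copies D P1 X P2 Xs ->
  (forall i, D (t i)) -> (forall i, measurable (E i)) ->
  P2 [set w | forall i, E i [tuple Xs i (t j) w | j < k]] =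
  (\prod_i P1 [set w | E i [tuple X (t j) w | j < k]])%E.
Proof.
move=> [mXs fdd ind] Dt mE.
have := ind [set: 'I_m]%SET (fun i =>
  [set w | E i [tuple Xs i (t j) w | j < k]]).
rewrite (_ : \bigcap_(i in _) _ =
    [set w | forall i, E i [tuple Xs i (t j) w | j < k]]); last first.
  by apply/seteqP; split => w /= Ew i;
    [apply: Ew; rewrite /= inE|move=> _; exact: Ew].
move=> -> => [|i _].
  by apply: eq_big => [i|i _]; [rewrite inE|exact: fdd].
pose G := \bigcup_(s in D) preimage_set_system setT (Xs i s) measurable.
(* Independence concerns the sigma-algebras generated by the fields, so measurability is needed for
   that sigma-algebra rather than for the ambient one. *)
have mt : measurable_fun setT (fun w : g_sigma_algebraType G =>
  [tuple Xs i (t j) w | j < k]).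
  apply: measurable_tuple_field => j _ B mB; apply: sub_sigma_algebra.
  by exists (t j) => //; exists B.
exact: (@measurable_preimage _ _ (g_sigma_algebraType G) _ _ (E i) mt (mE i)).
Qed.

End independent_copies_law.

(** Arranged as an [m]-tuple of [k]-tuples, the whole array has a law determined by boxes with
    arbitrary measurable sides in dimension [k]; the vector of sums is a measurable function of the
    array. *)
Lemma box_law_sum (R : realType) d1 d2 (O1 : measurableType d1)
    (O2 : measurableType d2) (P1 : probability O1 R) (P2 : probability O2 R)
    (m k : nat) (X1 : 'I_m -> 'I_k -> O1 -> R) (X2 : 'I_m -> 'I_k -> O2 -> R) :
  (forall i j, measurable_fun setT (X1 i j)) ->
  (forall i j, measurable_fun setT (X2 i j)) ->
  (forall E : 'I_m -> set (k.-tuple R), (forall i, measurable (E i)) ->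
    P1 [set w | forall i, E i [tuple X1 i j w | j < k]] =
    P2 [set w | forall i, E i [tuple X2 i j w | j < k]]) ->
  forall A : set (k.-tuple R), measurable A ->
    P1 [set w | A [tuple \sum_i X1 i j w | j < k]] =
    P2 [set w | A [tuple \sum_i X2 i j w | j < k]].
Proof.
move=> mX1 mX2 X12 A mA.
pose V d (O : measurableType d) (X : 'I_m -> 'I_k -> O -> R) w :=
  [tuple [tuple X i j w | j < k] | i < m].
have mV d (O : measurableType d) (X : 'I_m -> 'I_k -> O -> R) :
    (forall i j, measurable_fun setT (X i j)) -> measurable_fun setT (V _ _ X).
  move=> mX; apply/measurable_fun_tnthP => i.
  rewrite (_ : _ \o _ = fun w => [tuple X i j w | j < k]).
    by apply: measurable_tuple_field => j.
  by apply/funext => w /=; rewrite tnth_mktuple.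
pose S (x : m.-tuple (k.-tuple R)) := [tuple \sum_i tnth (tnth x i) j | j < k].
have mS : measurable_fun setT S.
  apply: measurable_tuple_field => j; apply: measurable_sum => i.
  apply: (@measurableT_comp _ _ _ _ _ _ (fun y : k.-tuple R => tnth y j)).
    exact: measurable_tnth.
  exact: measurable_tnth.
have SV d (O : measurableType d) (X : 'I_m -> 'I_k -> O -> R) :
    [set w | A [tuple \sum_i X i j w | j < k]] = V _ _ X @^-1` (S @^-1` A).
  have SVE w : S (V _ _ X w) = [tuple \sum_i X i j w | j < k].
    apply: eq_from_tnth => j; rewrite !tnth_mktuple.
    by apply: eq_bigr => i _; rewrite !tnth_mktuple.
  by apply/seteqP; split => w /=; rewrite SVE.
rewrite !SV.
apply: (tuple_measure_unique (G := measurable) _ _ _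
  (m1 := mpushforward (mV _ _ _ mX1) P1)
    (m2 := mpushforward (mV _ _ _ mX2) P2)).
- by rewrite smallest_id//; exact: sigma_algebra_measurable.
- by move=> ? ?; exact: measurableI.
- exact: measurableT.
- by rewrite /= /pushforward preimage_setT probability_setT ltry.
- move=> E mE; rewrite /= /pushforward.
  have box d (O : measurableType d) (X : 'I_m -> 'I_k -> O -> R) :
      V _ _ X @^-1` tuple_box E = [set w | forall i, E i
        [tuple X i j w | j < k]].
    by apply/seteqP; split => w /= Ew i; have := Ew i; rewrite tnth_mktuple.
  by rewrite !box; exact: X12.
exact: measurable_preimage mS mA.
Qed.

(** * Invariance of Lebesgue measure *)

(** The image measure multiplied by [c] gives each half-open interval its length, so it is Lebesgue
    measure. *)
Lemma lebesgue_measure_affine (R : realType) (c s : R) (A : set R) : 0 < c ->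
  measurable A ->
  (lebesgue_measure ((fun x : R => c * x + s)%R @^-1` A) =
   (c^-1)%:E * lebesgue_measure A)%E.
Proof.
move=> c0 mA.
have ci0 : 0 <= c^-1 by rewrite invr_ge0 ltW.
have mf : measurable_fun [set: measurableTypeR R]
  (fun x : measurableTypeR R => c * x + s : measurableTypeR R).
  have : measurable_fun setT (fun x : R => c * x + s).
    by apply: measurable_funD => //; exact: measurable_funM.
  exact.
pose m1 := mscale (NngNum (ltW c0)) (mpushforward mf lebesgue_measure).
have /(_ A mA) : forall A, measurable A -> lebesgue_measure A = m1 A.
  apply: lebesgue_measure_unique => _ [[a b] _ <-] /=.
  rewrite /m1 /mscale /= /pushforward.
  rewrite (_ : _ @^-1` _ = `](a - s) / c, (b - s) / c]%classic); last first.
    apply/seteqP; split => x /=; rewrite !in_itv /= ltr_pdivrMr// ler_pdivlMr//;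
    by rewrite ltrBlDr lerBrDr (mulrC x).
  rewrite !lebesgue_measure_itv /= !lte_fin ltr_pM2r ?invr_gt0// ltrD2r.
  case: ifP => _; last by rewrite mule0.
  rewrite -!EFinB -EFinM; congr EFin; field; exact: lt0r_neq0.
rewrite /m1 /mscale /= /pushforward => ->.
by rewrite muleA -EFinM mulVf ?mul1e// lt0r_neq0.
Qed.

Definition sym_itv (R : realType) (c : R) : set R := `](- c), c]%classic.

Lemma lebesgue_measure_sym_itv (R : realType) (c : R) : 0 < c ->
  lebesgue_measure (sym_itv c) = (c + c)%:E.
Proof.
move=> c0; rewrite /sym_itv lebesgue_measure_itv /= lte_fin gtrN// -EFinB
  opprK//.
Qed.

Lemma sym_itvP (R : realType) (c x : R) : sym_itv c x <-> - c < x <= c.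
Proof. by rewrite /sym_itv /= in_itv. Qed.

Lemma measurable_sym_itv (R : realType) (c : R) : measurable (sym_itv c).
Proof. exact: measurable_itv. Qed.
#[local] Hint Resolve measurable_sym_itv : core.

Section lebesgue_tuple_theory.
Context {R : realType} {d : nat}.
Implicit Types (x y s : d.-tuple R).

Lemma lebesgue_sym_box (c : R) : 0 < c ->
  lebesgue_tuple d (tuple_box (fun=> sym_itv c)) = ((c + c) ^+ d)%:E.
Proof.
move=> c0; rewrite (lebesgue_tuple_box (A := fun=> sym_itv c))//.
under eq_bigr do rewrite lebesgue_measure_sym_itv//.
by rewrite prodEFin prodr_const card_ord.
Qed.

Lemma lebesgue_tuple_unique (m1 : {measure set (d.-tuple R) -> \bar R}) :
  (forall E : 'I_d -> set R, (forall i, measurable (E i)) ->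
    lebesgue_tuple d (tuple_box E) = m1 (tuple_box E)) ->
  forall A, measurable A -> lebesgue_tuple d A = m1 A.
Proof.
move=> boxE.
(* Cubes of finite volume exhausting the space, required because Lebesgue measure need not be
   finite; [k.+1] keeps the half-side positive. *)
pose g (k : nat) : set (d.-tuple R) :=
  tuple_box (fun=> sym_itv (k.+1%:R : R)).
have mR : @measurable _ R = <<s measurable >>.
  by rewrite smallest_id//; exact: sigma_algebra_measurable.
apply: (measure_unique (tuple_boxes measurable) g).
- exact: measurable_tuple_boxes.
- by apply: setI_closed_tuple_boxes => ? ?; exact: measurableI.
- by move=> k; exists (fun=> sym_itv (k.+1%:R : R)) => // i;
  exact: measurable_sym_itv.
- apply/seteqP; split => // x _.
  exists (\max_(i < d) (Num.truncn `|tnth x i|).+1)%N => // i.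
  have xi : `|tnth x i| < (\max_(i < d) (Num.truncn `|tnth x i|).+1).+1%:R.
    apply: lt_trans (truncnS_gt _) _; rewrite ltr_nat ltnS.
    exact: (leq_bigmax (F := fun i => (Num.truncn `|tnth x i|).+1)).
  by apply/sym_itvP; move: xi; rewrite ltr_norml => /andP[-> /ltW].
- by move=> _ [E mE <-]; exact: boxE.
- by move=> k; rewrite lt_neqAle leey andbT;
  apply/eqP => /(etrans (esym (lebesgue_sym_box (ltr0Sn R k)))).
Qed.

Definition vzero : d.-tuple R := [tuple 0 | i < d].

Definition vaffine (c : R) s x : d.-tuple R :=
  [tuple c * tnth x i + tnth s i | i < d].

Lemma measurable_vaffine c s : measurable_fun setT (vaffine c s).
Proof.
apply: measurable_tuple_field => i; apply: measurable_funD => //.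
by apply: measurable_funM => //; exact: measurable_tnth.
Qed.

(** The preimage of a box is a box, each side contributing a factor 1/c; uniqueness on boxes extends
    this. Shifts are the case [c = 1], dilations the case [s = vzero]. *)
Lemma lebesgue_tuple_affine (c : R) s (A : set (d.-tuple R)) : 0 < c ->
  measurable A ->
  lebesgue_tuple d (vaffine c s @^-1` A) = ((c ^- d)%:E * lebesgue_tuple d A)%E.
Proof.
move=> c0 mA.
have cd0 : 0 <= c ^+ d by rewrite exprn_ge0// ltW.
pose m1 := mscale (NngNum cd0) (mpushforward (measurable_vaffine c s)
  (lebesgue_tuple d)).
have -> : lebesgue_tuple d A = m1 A.
  apply: lebesgue_tuple_unique mA => E mE.
  rewrite -[RHS]/((c ^+ d)%:E * lebesgue_tuple d
    (vaffine c s @^-1` tuple_box E))%E.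
  have -> : vaffine c s @^-1` tuple_box E =
      tuple_box (fun i => (fun x : R => c * x + tnth s i)%R @^-1` E i).
    by apply/seteqP; split => x /= Ex i; have := Ex i; rewrite tnth_mktuple.
  have mE' i : measurable ((fun x : R => c * x + tnth s i)%R @^-1` E i).
    apply: (measurable_preimage _ (mE i)).
    by apply: measurable_funD => //; exact: measurable_funM.
  rewrite (lebesgue_tuple_box mE) (lebesgue_tuple_box mE').
  under [in RHS]eq_bigr do rewrite lebesgue_measure_affine//.
  rewrite big_split /= prodEFin prodr_const card_ord muleA -EFinM.
  by rewrite exprVn mulfV ?mul1e// expf_neq0// lt0r_neq0.
rewrite -[m1 A]/((c ^+ d)%:E * lebesgue_tuple d (vaffine c s @^-1` A))%E.
rewrite muleA -EFinM mulVf ?mul1e//.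
by rewrite expf_neq0// lt0r_neq0.
Qed.

Lemma lebesgue_tuple_shift s (A : set (d.-tuple R)) : measurable A ->
  lebesgue_tuple d (vshift s @^-1` A) = lebesgue_tuple d A.
Proof.
move=> mA; rewrite (_ : vshift s = vaffine 1 s).
  by rewrite lebesgue_tuple_affine// expr1n invr1 mul1e.
by apply/funext => x; apply: eq_from_tnth => i; rewrite !tnth_mktuple mul1r.
Qed.

Lemma lebesgue_tuple_scale (c : R) (A : set (d.-tuple R)) : 0 < c ->
  measurable A ->
  lebesgue_tuple d (vscale c @^-1` A) = ((c ^- d)%:E * lebesgue_tuple d A)%E.
Proof.
move=> c0 mA; rewrite (_ : vscale c = vaffine c vzero).
  exact: lebesgue_tuple_affine.
by apply/funext => x; apply: eq_from_tnth => i; rewrite !tnth_mktuple addr0.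
Qed.

Lemma measurable_eucl_dist d' (S : measurableType d') (f g : S -> d.-tuple R) :
  measurable_fun setT f -> measurable_fun setT g ->
  measurable_fun setT (fun w => eucl_dist (f w) (g w)).
Proof.
move=> mf mg; rewrite /eucl_dist.
have msq : measurable_fun setT (fun w =>
  \sum_(i < d) (tnth (g w) i - tnth (f w) i) ^+ 2).
  apply: measurable_sum => i; apply: measurable_funX; apply: measurable_funB.
    exact: (measurableT_comp (@measurable_tnth _ _ _ i) mg).
  exact: (measurableT_comp (@measurable_tnth _ _ _ i) mf).
apply: (measurableT_comp _ msq).
by apply: continuous_measurable_fun; exact: sqrt_continuous.
Qed.

Lemma measurable_eucl_ball x r : measurable (eucl_ball x r).
Proof.
rewrite -[X in measurable X]setTI; apply: measurable_fun_ltr => //.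
exact: measurable_eucl_dist.
Qed.

Lemma lebesgue_ball_gt0 : (0 < lebesgue_tuple d (eucl_ball vzero 1))%E.
Proof.
(* Since c <= 1, a point of the cube of half-side [c] has squared norm at most d c = d / (d + 1) <
   1, so the cube lies in the unit ball. *)
pose c : R := d.+1%:R^-1.
have c0 : 0 < c by rewrite invr_gt0.
have mbox : measurable (tuple_box (fun _ : 'I_d => sym_itv (c : R))).
  by apply: measurable_tuple_box => i; exact: measurable_sym_itv.
apply: (@lt_le_trans _ _ (lebesgue_tuple d
  (tuple_box (fun=> sym_itv (c : R))))).
  by rewrite lebesgue_sym_box// lte_fin exprn_gt0// addr_gt0.
rewrite le_measure ?inE//; first exact: measurable_eucl_ball.
move=> x xc; rewrite /eucl_ball /eucl_dist /=.
rewrite -[ltRHS]sqrtr1 ltr_sqrt//.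
apply: (@le_lt_trans _ _ (\sum_(i < d) c)).
  apply: ler_sum => i _; rewrite tnth_mktuple subr0.
  have : `|tnth x i| <= c.
    by have /sym_itvP := xc i; rewrite ler_norml => /andP[/ltW -> ->].
  move=> xic; rewrite -real_normK ?num_real// expr2.
  have c1 : c <= 1 by rewrite invf_le1// ler1n.
  apply: (le_trans (ler_pM _ _ xic (le_trans xic c1))) => //.
  by rewrite mulr1.
by rewrite sumr_const card_ord -mulr_natl ltr_pdivrMr// mul1r ltr_nat.
Qed.

Lemma lebesgue_ball_lty : (lebesgue_tuple d (eucl_ball vzero 1) < +oo)%E.
Proof.
apply: (@le_lt_trans _ _ (lebesgue_tuple d
  (tuple_box (fun=> sym_itv (1 : R))))).
  rewrite le_measure ?inE//; [exact: measurable_eucl_ball| |].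
    by apply: measurable_tuple_box => i; exact: measurable_sym_itv.
  move=> x; rewrite /eucl_ball /eucl_dist /= -[ltRHS]sqrtr1 ltr_sqrt// => xs i.
  have : `|tnth x i| < 1.
    rewrite -(@expr_lt1 _ 2)// ?real_normK ?num_real//.
    apply: le_lt_trans xs; rewrite (bigD1 i)//= tnth_mktuple subr0 lerDl.
    by apply: sumr_ge0 => j _; exact: sqr_ge0.
  by move=> xi; apply/sym_itvP; move: xi; rewrite ltr_norml => /andP[-> /ltW].
by rewrite lebesgue_sym_box// ltry.
Qed.

End lebesgue_tuple_theory.

Lemma mule_fin_can (R : realFieldType) (x y b : \bar R) :
  (b \is a fin_num -> b != 0 -> x * b = b * y -> x = y)%E.
Proof.
case: b => // b _ b0; rewrite [RHS]muleC.
move=> /(congr1 (fun z => z * (b^-1)%:E)%E).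
by rewrite -!muleA -EFinM mulfV// !mule1.
Qed.

(** * Invariance of Lebesgue measure under orthogonal maps *)

Section rotations.
Context {R : realType} {d : nat}.
Implicit Types (x y s : d.-tuple R) (Theta : 'M[R]_d).
Local Notation leb := (lebesgue_tuple
  d : {sigma_finite_measure set (d.-tuple R) -> \bar R}).

Lemma orthogonal_mx_tr Theta : orthogonal_mx Theta -> orthogonal_mx Theta^T.
Proof. by rewrite /orthogonal_mx trmxK => /mulmx1C. Qed.

Lemma vlinK Theta : orthogonal_mx Theta -> cancel (vlin Theta) (vlin Theta^T).
Proof.
move=> oT x; apply: eq_from_tnth => i; rewrite tnth_mktuple.
under eq_bigr do rewrite tnth_mktuple mulr_sumr.
rewrite exchange_big /= (bigD1 i)//= [X in _ + X]big1 ?addr0.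
  under eq_bigr do rewrite mulrA.
  rewrite -mulr_suml; have /matrixP/(_ i i) := oT.
  by rewrite !mxE eqxx mulr1n => ->; rewrite mul1r.
move=> j ji; under eq_bigr do rewrite mulrA.
rewrite -mulr_suml; have /matrixP/(_ i j) := oT.
by rewrite !mxE eq_sym (negbTE ji) mulr0n => ->; rewrite mul0r.
Qed.

Lemma vlinKV Theta : orthogonal_mx Theta -> cancel (vlin Theta^T) (vlin Theta).
Proof.
by move=> oT x; have := vlinK (orthogonal_mx_tr oT) x; rewrite trmxK.
Qed.

(** Moving one factor [Theta] to the other side of the inner product turns it into its transpose,
    which is its inverse. *)
Lemma sqr_norm_vlin Theta x : orthogonal_mx Theta ->
  \sum_i tnth (vlin Theta x) i ^+ 2 = \sum_i tnth x i ^+ 2.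
Proof.
move=> oT; transitivity (\sum_j tnth (vlin Theta^T (vlin Theta x)) j * tnth x
  j).
  under [RHS]eq_bigr do rewrite tnth_mktuple mulr_suml.
  rewrite exchange_big; apply: eq_bigr => i _ /=.
  rewrite expr2 {1}tnth_mktuple mulr_suml; apply: eq_bigr => j _.
  by rewrite mxE -!mulrA; congr (_ * _); rewrite mulrC.
by rewrite vlinK//; apply: eq_bigr => i _; rewrite expr2.
Qed.

Lemma vlin_shift Theta s x : vlin Theta (vshift s x) =
  vshift (vlin Theta s) (vlin Theta x).
Proof.
apply: eq_from_tnth => i; rewrite !tnth_mktuple -big_split /=.
by apply: eq_bigr => j _; rewrite tnth_mktuple mulrDr.
Qed.

Lemma eucl_dist_vlin Theta x y : orthogonal_mx Theta ->
  eucl_dist x (vlin Theta y) = eucl_dist (vlin Theta^T x) y.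
Proof.
move=> oT; congr Num.sqrt.
pose z := [tuple tnth y i - tnth (vlin Theta^T x) i | i < d].
rewrite [RHS](_ : _ = \sum_i tnth z i ^+ 2); last first.
  by apply: eq_bigr => i _; rewrite [in RHS]tnth_mktuple.
rewrite -(sqr_norm_vlin z oT); apply: eq_bigr => i _; congr (_ ^+ 2).
have -> : tnth x i = tnth (vlin Theta (vlin Theta^T x)) i.
  by rewrite vlinKV.
rewrite [in LHS]tnth_mktuple [X in _ - X]tnth_mktuple [RHS]tnth_mktuple.
rewrite -sumrB; apply: eq_bigr => j _; rewrite -mulrBr; congr (_ * _).
by rewrite [in RHS]tnth_mktuple.
Qed.

Lemma vshiftC s x : vshift s x = vshift x s.
Proof. by apply: eq_from_tnth => i; rewrite !tnth_mktuple addrC. Qed.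

Lemma eucl_distC x y : eucl_dist x y = eucl_dist y x.
Proof.
by congr Num.sqrt; apply: eq_bigr => i _; rewrite -sqrrN opprB.
Qed.

Lemma eucl_dist_shift s x : eucl_dist s (vshift s x) = eucl_dist vzero x.
Proof.
by congr Num.sqrt; apply: eq_bigr => i _; rewrite !tnth_mktuple addrK subr0.
Qed.

Let prod_ysection (E : set (d.-tuple R * d.-tuple R)) : measurable E ->
  (\int[leb]_y leb (ysection E y) = \int[leb]_x leb (xsection E x))%E.
Proof.
move=> mE.
rewrite -[RHS]/((leb \x leb)%E E) -[LHS]/((leb \x^ leb)%E E).
by apply/esym; apply: product_measure_unique => // A B mA mB;
  exact: product_measure2E.
Qed.

Lemma measurable_vshift2 d' (S : measurableType d') (f g : S -> d.-tuple R) :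
  measurable_fun setT f -> measurable_fun setT g ->
  measurable_fun setT (fun w => vshift (f w) (g w)).
Proof.
move=> mf mg; apply: measurable_tuple_field => i; apply: measurable_funD.
  exact: (measurableT_comp (@measurable_tnth _ _ _ i) mg).
exact: (measurableT_comp (@measurable_tnth _ _ _ i) mf).
Qed.

(* Fubini for {(x, y) | Theta x + y \in A, |y| < 1}: slicing at y gives
   leb (Theta^-1 A) leb (B(0,1)) by translation invariance, and slicing at x,
   translating, and slicing back gives leb A leb (B(0,1)), the unit ball being
   mapped to itself by Theta. *)
Lemma lebesgue_tuple_rotation Theta (A : set (d.-tuple R)) :
  orthogonal_mx Theta -> measurable A ->
  leb (vlin Theta @^-1` A) = leb A.
Proof.
move=> oT mA.
pose B := eucl_ball (vzero : d.-tuple R) 1.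
have mB : measurable B by exact: measurable_eucl_ball.
have mv : measurable_fun setT (vlin Theta) by exact: measurable_vlin.
have mx : measurable_fun setT (fun z : d.-tuple R * d.-tuple R =>
  vlin Theta z.1).
  exact: (measurableT_comp mv).
pose E1 := [set z : d.-tuple R * d.-tuple R | A (vshift z.2 (vlin Theta z.1))
  /\ B z.2].
(* Obtained from [E1] by translating the second coordinate by [Theta x], so sections at [x] have
   equal measure; its section at a point [y] of [A] is the unit ball centred at [Theta^T y]. *)
pose E2 := [set z : d.-tuple R * d.-tuple R | A z.2 /\ eucl_dist
  (vlin Theta z.1) z.2 < 1].
have mE1 : measurable E1.
  apply: measurableI.
    by apply: (measurable_preimage _ mA); exact: measurable_vshift2.
  exact: (measurable_preimage _ mB).
have mE2 : measurable E2.
  apply: measurableI; first exact: (measurable_preimage _ mA).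
  rewrite -[X in measurable X]setTI; apply: measurable_fun_ltr => //.
  exact: measurable_eucl_dist.
have sectionE (E : set (d.-tuple R * d.-tuple R)) x y :
  (ysection E y x = E (x, y)) *
    (xsection E x y = E (x, y)).
  by rewrite /ysection /xsection /=; split; apply/propext; rewrite inE.
have y1 y : leb (ysection E1 y) = (leb (vlin Theta @^-1` A) * (\1_B y)%:E)%E.
  rewrite indicE; case: (boolP (y \in B)) => /= yB.
    rewrite mule1 -(lebesgue_tuple_shift (vlin Theta^T y)
      (measurable_preimage mv mA)).
    congr (leb _); apply/seteqP; split => x;
      rewrite sectionE /= vlin_shift vlinKV//.
      by case.
    by move=> ?; split => //; exact: set_mem.
  rewrite mule0 (_ : ysection _ _ = set0) ?measure0//.
  by apply/seteqP; split => // x; rewrite sectionE /E1 /= => -[_ /mem_set];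
    rewrite (negbTE yB).
have y2 y : leb (ysection E2 y) = (leb B * (\1_A y)%:E)%E.
  rewrite indicE; case: (boolP (y \in A)) => /= yA.
    rewrite mule1; transitivity (leb (eucl_ball (vlin Theta^T y) 1)).
      congr (leb _); apply/seteqP; split => x;
        rewrite sectionE /E2 /eucl_ball /=;
        rewrite [eucl_dist _ y]eucl_distC eucl_dist_vlin//; first by case.
      by split => //; exact: set_mem.
    rewrite -(lebesgue_tuple_shift (vlin Theta^T y) (measurable_eucl_ball _ 1)).
    by congr (leb _); apply/seteqP; split => x;
      rewrite /B /eucl_ball /= eucl_dist_shift.
  rewrite mule0 (_ : ysection _ _ = set0) ?measure0//.
  by apply/seteqP; split => // x; rewrite sectionE /E2 /= => -[/mem_set];
    rewrite (negbTE yA).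
have x12 x : leb (xsection E1 x) = leb (xsection E2 x).
  have m2 : measurable (xsection E2 x) by exact: measurable_xsection.
  rewrite -(lebesgue_tuple_shift (vlin Theta x) m2); congr (leb _).
  by apply/seteqP; split => y; rewrite /preimage /= !sectionE /E1 /E2 /B
    /eucl_ball /= eucl_dist_shift vshiftC.
have := prod_ysection mE1.
under [in RHS]eq_integral do rewrite x12.
rewrite -prod_ysection//.
under eq_integral do rewrite y1; under [in RHS]eq_integral do rewrite y2.
have mI (C : set (d.-tuple R)) : measurable C ->
  measurable_fun setT (fun y => (\1_C y)%:E : \bar R).
  by move=> mC; apply/measurable_EFinP; exact: measurable_indic.
rewrite !ge0_integralZl//; [|exact: mI..].
rewrite !integral_indic// !setIT => e.
(* The volume of the unit ball is cancelled, which is legitimate because it is neither 0 nor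
   infinite. *)
have Bfin : leb B \is a fin_num by rewrite ge0_fin_numE//;
  exact: lebesgue_ball_lty.
have B0 : leb B != 0%E by rewrite gt_eqF//; exact: lebesgue_ball_gt0.
exact: mule_fin_can Bfin B0 e.
Qed.

End rotations.

(** * Similarities acting on balls *)

(* A named copy of the product, carrying the sigma-finite instance needed by
   product_measure_unique. *)
Definition plane_measure (R : realType) (d : nat) :
  set (d.-tuple R * measurableTypeR R) -> \bar R :=
  (lebesgue_tuple d \x @lebesgue_measure R)%E.

HB.instance Definition _ (R : realType) (d : nat) :=
  Measure.on (@plane_measure R d).
HB.instance Definition _ (R : realType) (d : nat) :=
  Measure_isSigmaFinite.Build _ _ _ (@plane_measure R d)
    (sigma_finite_product (lebesgue_tuple d) (@lebesgue_measure R)).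

Section intensity_scaling.
Context {R : realType} {d : nat} (beta : R) (Cb : {posnum R}).
Variable G : probability R R.
Variables (f : d.-tuple R -> d.-tuple R) (b c : R).
Hypotheses (mf : measurable_fun setT f) (b0 : 0 < b) (c0 : 0 < c).
Hypothesis fE : forall A, measurable A ->
  lebesgue_tuple d (f @^-1` A) = (c%:E * lebesgue_tuple d A)%E.

Definition ball_map (z : ball_space R d) : ball_space R d :=
  (f z.1.1, b^-1 * z.1.2, z.2).

Lemma measurable_ball_map : measurable_fun setT ball_map.
Proof.
apply: measurable_fun_pair; last exact: measurable_snd.
apply: measurable_fun_pair.
  apply: (measurableT_comp mf).
  exact: (measurableT_comp measurable_fst measurable_fst).
have m1 : measurable_fun setT (fun r : measurableTypeR R =>
  b^-1 * r : measurableTypeR R).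
  have : measurable_fun setT (fun r : R => b^-1 * r) by exact: measurable_funM.
  exact.
apply: (measurableT_comp m1).
exact: (measurableT_comp measurable_snd measurable_fst).
Qed.

Let cb0 : 0 <= (c * b)^-1.
Proof. by rewrite invr_ge0 mulr_ge0// ltW. Qed.

Let scale_lebesgue (A : set R) : measurable A ->
  lebesgue_measure ((fun r : R => b^-1 * r) @^-1` A) =
    (b%:E * lebesgue_measure A)%E.
Proof.
move=> mA; have bi0 : 0 < b^-1 by rewrite invr_gt0.
have := lebesgue_measure_affine 0 bi0 mA; rewrite invrK => <-.
by apply: congr1; apply/seteqP; split => r /=; rewrite addr0.
Qed.

Let plane_map (z : d.-tuple R * measurableTypeR R) :
  d.-tuple R * measurableTypeR R :=
  (f z.1, b^-1 * z.2).

Let measurable_plane_map : measurable_fun setT plane_map.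
Proof.
apply: measurable_fun_pair; first exact: (measurableT_comp mf).
have m1 : measurable_fun setT (fun r : measurableTypeR R =>
  b^-1 * r : measurableTypeR R).
  have : measurable_fun setT (fun r : R => b^-1 * r) by exact: measurable_funM.
  exact.
exact: (measurableT_comp m1 measurable_snd).
Qed.

Let plane_mapE A : measurable A ->
  ((lebesgue_tuple d \x @lebesgue_measure R) A =
   ((c * b)^-1)%:E * (lebesgue_tuple d \x @lebesgue_measure R)
     (plane_map @^-1` A))%E.
Proof.
pose m' := mscale (NngNum cb0)
  (mpushforward measurable_plane_map (lebesgue_tuple d \x @lebesgue_measure
    R)%E).
move=> mA0; apply: (@product_measure_unique _ _ _ _ R (lebesgue_tuple d)
  (@lebesgue_measure R) m' _ A mA0).
move=> {mA0}{}A B mA mB.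
rewrite -[LHS]/(((c * b)^-1)%:E * (lebesgue_tuple d \x @lebesgue_measure R)
   ((f @^-1` A) `*` ((fun r : R => (b^-1 * r)%R) @^-1` B)))%E.
have mB' : measurable ((fun r : R => b^-1 * r) @^-1` B).
  by apply: (measurable_preimage _ mB); exact: measurable_funM.
have e := product_measure1E (lebesgue_tuple d) (@lebesgue_measure R)
  (measurable_preimage mf mA) mB'.
apply: (etrans (congr1 (fun x => ((c * b)^-1)%R%:E * x)%E e)).
have e2 := congr2 (fun x y => x * y)%E (fE mA) (scale_lebesgue mB).
apply: (etrans (congr1 (fun x => ((c * b)^-1)%R%:E * x)%E e2)).
suff cancel x y : (((c * b)^-1)%R%:E * ((c%:E * x) * (b%:E * y)) = x * y)%E
  by exact: cancel.
rewrite [X in (_ * X)%E]muleACA -EFinM [LHS]muleA -EFinM mulVf ?mul1e//.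
by rewrite mulf_neq0// lt0r_neq0.
Qed.

(** Uniqueness of product measures is used twice: [plane_mapE] treats centre and radius, with
    factors [c] and [b], and the mark, left unchanged, is adjoined here. *)
Lemma reference_measure_ball_map A : measurable A ->
  (reference_measure d G A =
   ((c * b)^-1)%:E * reference_measure d G (ball_map @^-1` A))%E.
Proof.
pose m' := mscale (NngNum cb0)
  (mpushforward measurable_ball_map (reference_measure d G)).
move=> mA0; have H := @product_measure_unique _ _ _ _ R
  (@plane_measure R d) G m'.
apply: (fun rect => H rect A mA0).
move=> {mA0}{}A B mA mB.
rewrite -[LHS]/(((c * b)^-1)%:E * reference_measure d G
   ((plane_map @^-1` A) `*` B))%E.
have e := product_measure1E (@plane_measure R d) G
  (measurable_preimage measurable_plane_map mA) mB.
apply: (etrans (congr1 (fun x => ((c * b)^-1)%R%:E * x)%E e)).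
rewrite muleA; congr (_ * _)%E; apply/esym; exact: plane_mapE.
Qed.

Let measurable_density :
  measurable_fun setT (fun z : ball_space R d =>
    (radial_density beta Cb z.1.2)%:E).
Proof.
apply/measurable_EFinP; apply: (@measurableT_comp _ _ _ _ _ _
  (radial_density beta Cb)).
  apply: measurable_fun_ifT => //; first exact: measurable_fun_ltr.
  by apply: measurable_funM => //; exact: measurable_powR.
exact: measurableT_comp.
Qed.

Let density_ge0 (r : R) : 0 <= radial_density beta Cb r.
Proof. by rewrite /radial_density; case: ifP => // _;
  rewrite mulr_ge0 ?powR_ge0. Qed.

Let density_scale (r : R) :
  radial_density beta Cb r = b `^ (- beta - 1) * radial_density beta Cb
    (b^-1 * r).
Proof.
rewrite /radial_density pmulr_rgt0 ?invr_gt0//; case: ifP => [r0|_]; last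
  by rewrite mulr0.
rewrite mulrCA -powRM ?ltW// ?mulr_gt0 ?invr_gt0//.
by rewrite mulVKf// lt0r_neq0.
Qed.

(** The volume factor [c * b] of the change of variables meets the factor b^(-beta - 1) due to
    homogeneity of the radial density, leaving c b^(-beta). *)
Lemma intensity_ball_map A : measurable A ->
  (intensity d beta Cb G (ball_map @^-1` A) =
   (c * b `^ (- beta))%:E * intensity d beta Cb G A)%E.
Proof.
move=> mA; rewrite /intensity.
have bb0 : 0 <= b `^ (- beta - 1) by exact: powR_ge0.
have cb1 : 0 <= c * b by rewrite mulr_ge0// ltW.
(* The density at r is expressed through the density at r / b, so that the integrand becomes a
   function of [ball_map z]. *)
under eq_integral do rewrite density_scale EFinM.
have mpre := measurable_preimage measurable_ball_map mA.
have mdens : measurable_fun setT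
    (fun z => (radial_density beta Cb (ball_map z).1.2)%:E).
  exact: (measurableT_comp measurable_density measurable_ball_map).
have dens0 z : (ball_map @^-1` A) z ->
    (0 <= (radial_density beta Cb (ball_map z).1.2)%:E)%E by rewrite lee_fin.
rewrite (ge0_integralZl _ mpre (measurable_funTS mdens) dens0); last
  by rewrite lee_fin.
have := ge0_integral_mpushforward measurable_ball_map (reference_measure d G)
  mA measurable_density.
move=> /(_ (fun z => _)) <-; last by move=> z; rewrite lee_fin.
rewrite (@eq_measure_integral _ _ _ _
  (mscale (NngNum cb1) (reference_measure d G))).
  rewrite ge0_integral_mscale//; [|exact: measurable_funTS|by move=> z _;
    rewrite lee_fin].
  rewrite muleA -EFinM; congr (_%:E * _)%E => /=.
  rewrite mulrCA; congr (_ * _).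
  by rewrite mulrC -{1}(powRr1 (ltW b0)) -powRD ?subrKC// lt0r_neq0// implybT.
move=> B mB _; rewrite -[LHS]/(reference_measure d G (ball_map @^-1` B)).
rewrite -[RHS]/((c * b)%:E * reference_measure d G B)%E.
rewrite (reference_measure_ball_map mB) muleA -EFinM mulfV ?mul1e//.
by rewrite mulf_neq0// lt0r_neq0.
Qed.

End intensity_scaling.

Section ball_similarity.
Context {R : realType} {d : nat} (beta : R) (Cb : {posnum R}).
Variable G : probability R R.
Variables (g f : d.-tuple R -> d.-tuple R) (b c : R).
Hypotheses (mg : measurable_fun setT g) (mf : measurable_fun setT f).
Hypotheses (b0 : 0 < b) (c0 : 0 < c).
Hypothesis fE : forall A, measurable A ->
  lebesgue_tuple d (f @^-1` A) = (c%:E * lebesgue_tuple d A)%E.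
Hypothesis gf : forall x y, eucl_dist x (g y) = b * eucl_dist (f x) y.

Lemma preimage_eucl_ball x r : g @^-1` eucl_ball x r =
  eucl_ball (f x) (b^-1 * r).
Proof.
by apply/seteqP; split => y; rewrite /eucl_ball /= gf ltr_pdivlMl.
Qed.

Lemma ball_integrand_push (mu : signed_measure R d) :
  ball_integrand (cpushforward mg mu) = ball_integrand mu \o ball_map f b.
Proof.
apply/funext => z; rewrite /ball_integrand /ball_map /=.
by rewrite -preimage_eucl_ball.
Qed.

(** Ensures that [J] of the image measure is again one of the given compensated integrals. The
    exponents [p] and [q] are kept; only the constant changes. *)
Lemma Mspace_push (alpha : R) (mu : signed_measure R d) :
  measurable_fun setT (ball_integrand mu) ->
  Mspace alpha beta mu -> Mspace alpha beta (cpushforward mg mu).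
Proof.
move=> mh [C [p [q [pb bq bound]]]].
(* Replacing r by r / b multiplies r^p and r^q by b^-p and b^-q, both at most [K]. The absolute
   value of [C] is used because its sign is not prescribed. *)
pose K := Num.max (b^-1 `^ p) (b^-1 `^ q).
exists (c * (`|C| * K)), p, q; split => // r r0.
have br0 : 0 < b^-1 * r by rewrite mulr_gt0// invr_gt0.
pose F (x : d.-tuple R) := ((`|fine (mu (eucl_ball x (b^-1 * r)))| `^
  alpha)%:E : \bar R).
have mF : measurable_fun setT F.
  apply/measurable_EFinP.
  apply: (@measurableT_comp _ _ _ _ _ _ (fun t : R => t `^ alpha));
    first exact: measurable_powR.
  apply: measurableT_comp => //.
  (* At mark 1 and fixed radius the integrand is mu (B (x, r / b)), so the joint measurability [mh]
     yields measurability in the centre. *)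
  have mz : measurable_fun setT (fun x : d.-tuple R =>
    ((x, b^-1 * r : measurableTypeR R), 1 : R) : ball_space R d).
    by apply: measurable_fun_pair => //; apply: measurable_fun_pair.
  have := measurableT_comp mh mz.
  apply: eq_measurable_fun => x _; by rewrite /ball_integrand /= mul1r.
have -> : (\int[lebesgue_tuple d]_x
    (`|fine (cpushforward mg mu (eucl_ball x r))| `^ alpha)%:E =
    \int[lebesgue_tuple d]_x F (f x))%E.
  by apply: eq_integral => x _; rewrite /F -preimage_eucl_ball.
have F0 x : (0 <= F x)%E by rewrite lee_fin powR_ge0.
have := ge0_integral_mpushforward mf (lebesgue_tuple d) measurableT mF F0.
rewrite preimage_setT => <-.
rewrite (@eq_measure_integral _ _ _ _
  (mscale (NngNum (ltW c0)) (lebesgue_tuple d))); last first.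
  by move=> A mA _; exact: fE.
rewrite ge0_integral_mscale//.
rewrite -mulrA EFinM; apply: lee_wpmul2l; first by rewrite lee_fin ltW.
apply: (le_trans (bound _ br0)); rewrite lee_fin.
have K0 : 0 <= K by rewrite le_max powR_ge0.
apply: (@le_trans _ _ (`|C| * Num.min ((b^-1 * r) `^ p) ((b^-1 * r) `^ q))).
  by rewrite ler_wpM2r ?ler_norm// le_min !powR_ge0.
rewrite -mulrA ler_wpM2l// -[leRHS]mulrC minr_pMl// le_min !ge_min.
have bi0 : 0 <= b^-1 by rewrite invr_ge0 ltW.
rewrite !powRM ?(ltW r0)// ![_ * K]mulrC !ler_wpM2r ?powR_ge0//=.
- by rewrite orbT.
- by rewrite le_max lexx orbT.
- by rewrite le_max lexx.
Qed.

Context {disp : measure_display} {Omega : measurableType disp}.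
Variables (P : probability Omega R) (N : R.-ker Omega ~> ball_space R d).

Lemma compensated_ball_integral_push (mu : signed_measure R d)
  (Y : Omega -> R) :
  measurable_fun setT (ball_integrand mu) ->
  is_compensated_integral P (intensity d beta Cb G) N
    (ball_integrand (cpushforward mg mu)) Y ->
  is_compensated_integral P
    (mpushforward (measurable_ball_map b mf) (intensity d beta Cb G))
    (kpushforward (measurable_ball_map b mf) N) (ball_integrand mu) Y.
Proof.
move=> mh; rewrite ball_integrand_push.
exact: compensated_integral_pushforward.
Qed.

End ball_similarity.

(** Common core of all three claims. The invariances take kappa = 1 and compare with [N] itself;
    aggregate similarity takes kappa = m and compares with a superposition on another probability
    space. *)
Lemma fdd_eq_similarity (R : realType) (d : nat) (alpha beta : R)
    (Cb : {posnum R}) (G : probability R R) (disp : measure_display)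
    (Omega : measurableType disp) (P : probability Omega R)
    (N : R.-ker Omega ~> ball_space R d)
    (J : signed_measure R d -> Omega -> R)
    (g f : d.-tuple R -> d.-tuple R) (b c kappa : R)
    (mg : measurable_fun setT g) (mf : measurable_fun setT f)
    (disp' : measure_display) (Omega' : measurableType disp')
    (P' : probability Omega' R) (N' : R.-ker Omega' ~> ball_space R d)
    (nu : {measure set (ball_space R d) -> \bar R})
    (X : signed_measure R d -> Omega' -> R) :
  poisson_random_measure P (intensity d beta Cb G) N ->
  (forall mu, Mspace alpha beta mu ->
    is_compensated_integral P (intensity d beta Cb G) N (ball_integrand mu)
      (J mu)) ->
  0 < b -> 0 < c ->
  (forall A, measurable A ->
    lebesgue_tuple d (f @^-1` A) = (c%:E * lebesgue_tuple d A)%E) ->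
  (forall x y, eucl_dist x (g y) = b * eucl_dist (f x) y) ->
  c * b `^ (- beta) = kappa ->
  poisson_random_measure P' nu N' ->
  (forall A, measurable A -> nu A = (kappa%:E * intensity d beta Cb G A)%E) ->
  (forall mu, Mspace alpha beta mu ->
    is_compensated_integral P' nu N' (ball_integrand mu) (X mu)) ->
  fdd_eq (Mspace alpha beta) P (fun mu => J (cpushforward mg mu)) P' X.
Proof.
move=> hN hJ b0 c0 fE gf kE hN' nuE hX k t Dt A mA.
apply: (compensated_integral_unique (h := fun i => ball_integrand (t i))
  (N1 := kpushforward (measurable_ball_map b mf) N) (N2 := N') _
  (prm_pushforward _ hN) hN') => //.
- move=> B mB; rewrite nuE// -kE; exact: intensity_ball_map.
- move=> i; have mh : measurable_fun setT (ball_integrand (t i)).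
    by have [] := hJ _ (Dt i).
  apply: (compensated_ball_integral_push mf b0 gf mh).
  by apply: hJ; exact: (Mspace_push mg mf b0 c0 fE gf).
- by move=> i; exact: hX.
Qed.

Lemma eucl_dist_vscale (R : realType) (d : nat) (a : R) (x y : d.-tuple R) :
  0 < a -> eucl_dist x (vscale a y) = a * eucl_dist (vscale a^-1 x) y.
Proof.
move=> a0; rewrite /eucl_dist -[X in X * _]ger0_norm ?(ltW a0)// -sqrtr_sqr.
rewrite -sqrtrM ?sqr_ge0//; congr Num.sqrt.
rewrite mulr_sumr; apply: eq_bigr => i _; rewrite !tnth_mktuple -exprMn.
by rewrite mulrBr mulVKf// lt0r_neq0.
Qed.

Definition vopp (R : realType) (d : nat) (s : d.-tuple R) : d.-tuple R :=
  [tuple - tnth s i | i < d].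

Lemma eucl_dist_vshift (R : realType) (d : nat) (s x y : d.-tuple R) :
  eucl_dist x (vshift s y) = eucl_dist (vshift (vopp s) x) y.
Proof.
congr Num.sqrt; apply: eq_bigr => i _; rewrite !tnth_mktuple; congr (_ ^+ 2).
ring.
Qed.

Theorem proposition2p12 (R : realType) (d : nat) (hd : (0 < d)%N)
    (alpha beta : R) (Cb : {posnum R})
    (halpha : 1 < alpha <= 2) (hbeta : 0 < beta) (hbetad : beta != d%:R)
    (G : probability R R) (hG : normal_attraction alpha G)
    (disp : measure_display) (Omega : measurableType disp)
    (P : probability Omega R)
    (N : R.-ker Omega ~> ball_space R d)
    (hN : poisson_random_measure P (intensity d beta Cb G) N)
    (J : signed_measure R d -> Omega -> R)
    (hJ : forall mu, Mspace alpha beta mu ->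
      is_compensated_integral P (intensity d beta Cb G) N
        (ball_integrand mu) (J mu)) :
  (forall s : d.-tuple R,
     fdd_eq (Mspace alpha beta) P (fun mu => J (mtranslate s mu)) P J) /\
  (forall Theta : 'M[R]_d, orthogonal_mx Theta ->
     fdd_eq (Mspace alpha beta) P (fun mu => J (mrotate Theta mu)) P J) /\
  (forall m : nat, (1 <= m)%N ->
   forall (disp' : measure_display) (Omega' : measurableType disp')
     (P' : probability Omega' R)
     (Js : 'I_m -> signed_measure R d -> Omega' -> R),
     independent_copies (Mspace alpha beta) P J P' Js ->
     fdd_eq (Mspace alpha beta)
       P (fun mu => J (mdilate (m%:R `^ ((d%:R - beta)^-1)) mu))
       P' (fun mu w => \sum_(i < m) Js i mu w)).
Proof.
have prm_self A : measurable A ->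
    intensity d beta Cb G A = (1%:E * intensity d beta Cb G A)%E.
  by rewrite mul1e.
split; [move=> s|split; [move=> Theta oT|]].
- apply: (fdd_eq_similarity (b := 1) (c := 1) (kappa := 1)
    (measurable_vshift s) (measurable_vshift (vopp s)) hN hJ ltr01 ltr01 _ _ _
      hN prm_self hJ).
  + by move=> A mA; rewrite mul1e; exact: lebesgue_tuple_shift.
  + by move=> x y; rewrite mul1r; exact: eucl_dist_vshift.
  + by rewrite powR1 mulr1.
- apply: (fdd_eq_similarity (b := 1) (c := 1) (kappa := 1)
    (measurable_vlin Theta) (measurable_vlin Theta^T) hN hJ ltr01 ltr01 _ _ _
      hN prm_self hJ).
  + move=> A mA; rewrite mul1e; apply: lebesgue_tuple_rotation => //.
    exact: orthogonal_mx_tr.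
  + by move=> x y; rewrite mul1r; exact: eucl_dist_vlin.
  + by rewrite powR1 mulr1.
case=> // m _ disp' Omega' P' Js hJs.
have [dS [S [Q [M [nu [Z [hM nuE mZ hZ ZE]]]]]]] := iid_superposition hN hJ m.
set a := m.+1%:R `^ _.
have a0 : 0 < a by rewrite powR_gt0.
(* The dilated field is compared with the sum of the constructed copies by uniqueness of compensated
   integrals, and that sum with the given copies by equality of box probabilities. *)
move=> k t Dt A mA; transitivity (Q [set w | A
  [tuple \sum_i Z i (t j) w | j < k]]).
  apply: (fdd_eq_similarity (b := a) (c := a ^+ d) (kappa := m.+1%:R)
    (X := fun mu w => \sum_i Z i mu w)
    (measurable_vscale a) (measurable_vscale a^-1) hN hJ a0 (exprn_gt0 _ a0) _
      _ _ hM nuE hZ) => //.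
  + move=> B mB; rewrite lebesgue_tuple_scale ?invr_gt0//.
    by rewrite exprVn invrK.
  + by move=> x y; exact: eucl_dist_vscale.
  (* Here a^d a^(-beta) = a^(d - beta), and the exponent in [a] is the inverse of d - beta, which is
     nonzero because beta differs from d. *)
  + rewrite -powR_mulrn ?ltW// -powRD ?(lt0r_neq0 a0) ?implybT//.
    rewrite -powRrM mulVf ?powRr1// subr_eq0 eq_sym//.
have [mJs _ _] := hJs.
apply: (box_law_sum (X1 := fun i j => Z i (t j)) (X2 := fun i j => Js i (t j)))
  => //.
- by move=> i j; exact: mZ.
- by move=> i j; exact: mJs.
by move=> E mE; rewrite (independent_copies_boxes hJs Dt mE) ZE.
Qed.
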